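(* Let $p(x,y)=\sum_{|\alpha| = 2d, |\beta| \leq 2} c_{\alpha,\beta}x^\alpha y^\beta$, with $x\in\mathbb{R}^n$ and $y\in\mathbb{R}^m$, be homogeneous with degree $2d$ in $x$, and both quadratic and correlatively sparse in $y$. Suppose that: 1) the correlative sparsity graph of $p$ with respect to $y$ is chordal with maximal cliques $\mathcal{C}_1,\ldots,\mathcal{C}_t$; 2) $\sum_{|\alpha|=2d, |\beta| = 2} c_{\alpha,\beta}x^\alpha y^\beta > 0$ for all $x\in\mathbb{R}^n\setminus\{0\}$ and $y\in\mathbb{R}^m\setminus\{0\}$; 3) if $p$ is not homogeneous in $y$, then $p(x,y)>0$ for all $x \neq 0$ and $y\in\mathbb{R}^m$. Then there exist an integer $\nu\geq 0$ and SOS polynomials $\sigma_k(x,y_{\mathcal{C}_k})$, $k=1,\ldots,t$, quadratic in the second argument, such that $$\|x\|^{2\nu} p(x,y) = \sum_{k=1}^t \sigma_k\left(x,y_{\mathcal{C}_k}\right).$$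
   Context: Polynomials have real coefficients, $x=(x_1,\ldots,x_n)$, $y=(y_1,\ldots,y_m)$, $\|x\|^2=x_1^2+\cdots+x_n^2$; $\alpha\in\mathbb{N}^n$, $\beta\in\mathbb{N}^m$ are multi-indices with $|\alpha|=\sum_i\alpha_i$, $|\beta|=\sum_i\beta_i$. ''Quadratic'' in a variable means of degree at most $2$ in it. The coupling matrix $\mathrm{CSP}_y(p)\in\{0,1\}^{m\times m}$ has $(i,j)$ entry $1$ if $i=j$ or there exist $\alpha,\beta$ with $\beta_i\beta_j\neq 0$ and $c_{\alpha,\beta}\neq0$, and $0$ otherwise. The correlative sparsity graph of $p$ with respect to $y$ is the undirected graph with vertices $\{1,\ldots,m\}$ whose edges are the pairs $i\ne j$ with $[\mathrm{CSP}_y(p)]_{ij}=1$; ''correlatively sparse'' means merely that $\mathrm{CSP}_y(p)$ is sparse. A clique is a set of pairwise adjacent vertices; it is maximal if not contained in another clique. A graph is chordal if every cycle of length at least $4$ has an edge joining two nonconsecutive vertices. For a clique $\mathcal{C}$, $y_{\mathcal{C}}$ is the subvector of $y$ indexed by $\mathcal{C}$. An SOS polynomial is a finite sum of squares of polynomials. *)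

(* Defs.v *)
From mathcomp Require Import all_boot all_order all_algebra.
From mathcomp Require Import reals.
From mathcomp Require Import mpoly.

Set Implicit Arguments.
Unset Strict Implicit.
Unset Printing Implicit Defensive.

Import Order.TTheory GRing.Theory Num.Theory.

Local Open Scope ring_scope.

(* A polynomial in x = (x_1, ..., x_n) and y = (y_1, ..., y_m) is an element
   of {mpoly R[n + m]}: x_i is the variable lshift m i and y_j is the variable
   rshift n j. An exponent g of x and y is the pair of multi-indices
   alpha = xpart g and beta = ypart g. *)

Definition xpart (n m : nat) (g : 'X_{1..(n + m)}) : 'X_{1..n} :=
  [multinom g (lshift m i) | i < n].

Definition ypart (n m : nat) (g : 'X_{1..(n + m)}) : 'X_{1..m} :=
  [multinom g (rshift n j) | j < m].

Section Polynomials.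
Variable R : realType.

Definition eval_xy (n m : nat) (p : {mpoly R[n + m]})
    (x : 'rV[R]_n) (y : 'rV[R]_m) : R :=
  p.@[row_mx x y ord0].

Definition xhomog (n m k : nat) (p : {mpoly R[n + m]}) : Prop :=
  forall g, g \in msupp p -> mdeg (xpart g) = k.

Definition yhomog (n m k : nat) (p : {mpoly R[n + m]}) : Prop :=
  forall g, g \in msupp p -> mdeg (ypart g) = k.

Definition yquadratic (n m : nat) (p : {mpoly R[n + m]}) : Prop :=
  forall g, g \in msupp p -> (mdeg (ypart g) <= 2)%N.

(* The sum of the terms c_(alpha,beta) x^alpha y^beta of p with |alpha| = a
   and |beta| = b. *)
Definition bihomog_part (n m a b : nat) (p : {mpoly R[n + m]}) :
    {mpoly R[n + m]} :=
  \sum_(g <- msupp p | (mdeg (xpart g) == a) && (mdeg (ypart g) == b))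
     p@_g *: 'X_[g].

Definition normx2 (n m : nat) : {mpoly R[n + m]} :=
  \sum_(i < n) 'X_(lshift m i) ^+ 2.

Definition is_sos (k : nat) (q : {mpoly R[k]}) : Prop :=
  exists s : seq {mpoly R[k]}, q = \sum_(f <- s) f ^+ 2.

Definition csp (n m : nat) (p : {mpoly R[n + m]}) : 'M[nat]_m :=
  \matrix_(i, j) nat_of_bool
    ((i == j) || has (fun g => ypart g i * ypart g j != 0)%N (msupp p)).

Definition csp_graph (n m : nat) (p : {mpoly R[n + m]}) : rel 'I_m :=
  fun i j => (i != j) && (csp p i j == 1%N).

(* For q in the variables x_1, ..., x_n and #|C| further variables, subst_y q
   is q(x, y_C): the j-th further variable stands for the j-th element of C,
   in increasing order. *)
Definition subst_y (n m : nat) (C : {set 'I_m}) (q : {mpoly R[n + #|C|]}) :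
    {mpoly R[n + m]} :=
  q \mPo [tuple match split i with
                | inl k => 'X_(lshift m k)
                | inr j => 'X_(rshift n (enum_val j))
                end | i < n + #|C|].

End Polynomials.

Section Graphs.
Variable T : finType.
Variable e : rel T.

Definition clique (S : {set T}) : bool :=
  [forall i in S, forall j in S, (i != j) ==> e i j].

Definition maximal_clique (S : {set T}) : bool := maxset clique S.

Definition chordal : Prop :=
  forall s : seq T, (4 <= size s)%N -> cycle e s -> uniq s ->
    exists i j, [/\ i \in s, j \in s, i != j,
                    (next s i != j) && (next s j != i) & e i j].

End Graphs.

(* Main.v *)
Require Import Defs.
From mathcomp Require Import all_boot all_order all_algebra.
From mathcomp Require Import ring lra.
From mathcomp Require Import reals.
From mathcomp Require mpoly.
From mathcomp Require mathcomp_extra boolp classical_sets filter topology.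
From mathcomp Require normedtype derive.

(* Write p = sum_(u,v) M_uv(x) z_u z_v with z = (1, y), where the symmetric
   matrix M of forms of degree 2d has the sparsity of the graph and is positive
   definite for x <> 0. Put t_(i,j,+-) = (x_i +- x_j)^2. Every form of degree 2d
   in x is a form of degree d in t, so M(x) = F(t), and sum t = 4n|x|^2. The
   matrix F(t) need not be definite on the whole simplex, but it is at the
   points t coming from some x, and these are the zeros of a form P >= 0
   expressing that (x_i x_j) has rank one. By compactness
   G = (sum t)^4 F + lam (sum t)^d P I is definite on the simplex for a large
   lam, and G(t) = (4n|x|^2)^4 M(x) after the substitution. Polya's theorem for
   matrices writes (sum t)^N G as a sum of monomials t^w with positive
   semidefinite constant coefficients A_w that have the sparsity of M, because
   I is diagonal. Each t^w becomes a square, and each A_w is a sum of f f^T with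
   f supported on a clique, by eliminating simplicial vertices of the chordal
   graph one at a time. *)

Set Implicit Arguments.
Unset Strict Implicit.
Unset Printing Implicit Defensive.

(** * Simplicial vertices of chordal graphs *)

Section Dirac.
Variables (T : finType) (e : rel T).
Hypotheses (e_sym : symmetric e) (e_irr : irreflexive e) (e_chordal : chordal e).

(* A shortest path from [a] to [b] through [B], closed up by [u], is a cycle
   whose only possible chord is [a b]. *)
Lemma separator_adjacent (B : {set T}) (u a b : T) :
  (forall w, w \in B -> w != u /\ ~~ e u w) -> e u a -> e u b -> a != b ->
  connect (fun x y => e x y && (y \in b |: B)) a b -> e a b.
Proof.
move=> Bu ua ub ab conn.
(* Only the vertices after [a] are constrained: they lie in [B], except that [b] itself is
   allowed. *)
pose good s := [&& path e a s, last a s == b, all (mem (b |: B)) s & uniq (a :: s)].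
pose P n := [exists s : n.-tuple T, good s].
have exP : exists n, P n.
  have /connectP[s0 s0p s0b] := conn.
  case: (shortenP s0p) s0b => s sp us _ sb; exists (size s).
  apply/existsP; exists (in_tuple s); rewrite /good us -sb eqxx andbT /=.
  apply/andP; split; first by apply: sub_path sp => x y /andP[].
  elim: (s) (a) sp => //= x s' IHs a' /andP[/andP[_ xB]] sp'.
  by rewrite xB; apply: IHs sp'.
case: (ex_minnP exP) => n /existsP[[s /= sn] /and4P[sp sl sB us]] nmin.
move/eqP: sn => sn; move/eqP: sl => sl.
have smin s' : good s' -> size s <= size s'.
  by move=> gs'; rewrite sn; apply: nmin; apply/existsP; exists (in_tuple s').
apply: contraT => nab.
have s2 : 1 < size s.
  case: (s) sp sl => [_ /= ba|x [|y r] //=]; first by rewrite ba eqxx in ab.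
  by rewrite andbT => ax xb; rewrite xb (negPf nab) in ax.
have ne x y : e x y -> x != y.
  by move=> xy; apply: contraTneq xy => ->; rewrite e_irr.
have uc : uniq [:: u, a & s].
  rewrite cons_uniq us andbT inE negb_or ne //=.
  apply/negP => /(allP sB) /=; rewrite !inE (negPf (ne _ _ ub)) /=.
  by move=> /Bu []; rewrite eqxx.
have cc : cycle e [:: u, a & s].
  by rewrite /= ua /= rcons_path sp sl /= e_sym.
(* A chord at [u] could only reach [b], as the other vertices of [s] lie in [B]; a chord between two
   later vertices would shorten the path. *)
have key I J : I < J -> J < (size s).+2 -> J != I.+1 -> ~~ ((I == 0) && (J == (size s).+1)) ->
    ~~ e (nth u [:: u, a & s] I) (nth u [:: u, a & s] J).
  move=> IJ Js JI notends; apply/negP.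
  case: I IJ JI notends => [|I] IJ JI notends /=.
    case: J IJ Js JI notends => [//|[//|J]] _ Js _ nends /= uj.
    have js : nth u s J \in s by apply: mem_nth.
    have := allP sB _ js; rewrite /= in_setU1 => /orP[/eqP jb|/Bu[_]]; last by rewrite uj.
    have /eqP : nth u s J = nth u s (size s).-1.
      by rewrite jb -sl -nth_last; apply: set_nth_default; rewrite prednK // ltnW.
    have s1 : (size s).-1.+1 = size s by rewrite prednK // ltnW.
    rewrite nth_uniq //; [|by rewrite s1|by case/andP: us].
    by move=> /eqP JJ; move: nends; rewrite JJ s1 !eqxx.
  case: J IJ Js JI notends => [//|[//|J]] IJ Js JI _ /= ij.
  have IJ' : I < J by move: IJ JI; rewrite !ltnS leq_eqVlt eq_sym => /orP[/eqP->|//]; rewrite eqxx.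
  have Js' : J < size s by [].
  have Is' : I <= size s by apply: ltnW; apply: ltn_trans Js'.
  have sub : subseq (take I s ++ drop J s) s.
    rewrite -{3}(cat_take_drop J s); apply: cat_subseq => //.
    rewrite -(take_takel s (ltnW IJ')); exact: take_subseq.
  have : size s <= size (take I s ++ drop J s).
    apply: smin; apply/and4P; split.
    - rewrite cat_path take_path //= (drop_nth u Js') /=.
      have -> : last a (take I s) = nth u (a :: s) I.
        rewrite (last_nth u) size_take_min (minn_idPl _) //.
        by case: (I) => //= k; rewrite nth_take.
      rewrite ij /=.
      move: sp; rewrite -{1}(cat_take_drop J.+1 s) cat_path => /andP[_].
      rewrite (last_nth u) size_take_min (minn_idPl _) //=.
      by rewrite nth_take.
    - rewrite last_cat (drop_nth u Js') /=.
      rewrite -(last_cons a) -(drop_nth u Js') -{1}sl.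
      by rewrite -{2}(cat_take_drop J s) last_cat (drop_nth u Js').
    - by apply/allP => x /(mem_subseq sub) /(allP sB).
    - by apply: (subseq_uniq _ us); rewrite /= eqxx.
  rewrite size_cat size_take_min size_drop (minn_idPl Is') leqNgt -ltn_subRL.
  by rewrite ltn_sub2l // (ltn_trans IJ').
have [|i [j [ic jc ij /andP[nij nji] eij]]] := e_chordal _ cc uc.
  by rewrite /= !ltnS.
rewrite next_nth ic in nij; rewrite next_nth jc in nji.
have nextE x : nth u (a :: s) x = nth u [:: u, a & s] x.+1 by [].
rewrite !nextE in nij nji.
move: (ic) (jc); rewrite -!index_mem.
move: (nth_index u ic) (nth_index u jc) nij nji; move: (index i _) (index j _).
move=> I J iI jJ nij nji Is Js.
move: ij eij nij nji; rewrite -iI -jJ => ij eij nij nji.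
have IJ : I != J by apply: contraNneq ij => ->.
wlog lt : I J {i j ic jc iI jJ} ij eij nij nji Is Js IJ / I < J.
  move=> H; case: (ltngtP I J) => [lt|lt|eq].
  - exact: (H I J).
  - by apply: (H J I) => //; rewrite 1?eq_sym // e_sym.
  - by rewrite eq eqxx in IJ.
have := key I J lt; rewrite eij; apply.
- by [].
- by apply: contraNneq nij => ->.
- apply: contraNN nji => /andP[/eqP -> /eqP ->] /=.
  by rewrite nth_default.
Qed.

Definition simplicial (S : {set T}) v := clique e [set w in S | e v w].

(* Induction on [S]: let [B] be a component of the non-neighbours of [u] and [Z]
   its boundary, a clique; a simplicial vertex of [B :|: Z] lying in [B] is
   simplicial in [S]. *)
Lemma simplicial_nonneighbor (S : {set T}) u w0 :
  u \in S -> w0 \in S -> w0 != u -> ~~ e u w0 ->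
  exists v, [/\ v \in S, v != u, ~~ e u v & simplicial S v].
Proof.
elim: {S}_.+1 {-2}S (ltnSn #|S|) u w0 => // N IH S SN u w0 uS w0S w0u nuw0.
pose B0 := [set w in S | (w != u) && ~~ e u w].
pose r x y := [&& e x y, x \in B0 & y \in B0].
have r_sym : symmetric r by move=> x y; rewrite /r e_sym andbCA andbC andbA andbAC -!andbA.
have w0B : w0 \in B0 by rewrite inE w0S w0u.
pose B := [set w | connect r w0 w].
have inB w : (w \in B) = connect r w0 w by rewrite inE.
have BB0 w : w \in B -> w \in B0.
  rewrite inB => /connectP[s]; case: (lastP s) => [_ -> //|s' x].
  by rewrite rcons_path last_rcons => /andP[_ /and3P[_ _ h]] ->.
have w0_B : w0 \in B by rewrite inB connect0.
have Bstep x y : x \in B -> y \in B0 -> e x y -> y \in B.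
  move=> xB yB xy; have xB0 := BB0 _ xB.
  move: xB; rewrite !inB => xB; apply: connect_trans xB _.
  by apply: connect1; rewrite /r xy yB xB0.
pose Z := [set z in S | e u z && [exists b in B, e b z]].
have Bu w : w \in B -> w != u /\ ~~ e u w.
  by move=> /BB0; rewrite inE => /and3P[].
(* Each boundary vertex has a neighbour in the connected set [B], which gives the path through [B]
   that [separator_adjacent] asks for. *)
have Zadj a b : a \in Z -> b \in Z -> a != b -> e a b.
  rewrite !inE => /and3P[_ ua /exists_inP[x xB xa]] /and3P[_ ub /exists_inP[y yB yb]] ab.
  apply: (@separator_adjacent B u) => //.
  have xy : connect r x y.
    rewrite !inB in xB yB; apply: connect_trans yB.
    by rewrite (sym_connect_sym r_sym).
  apply: (@connect_trans _ _ x); first by apply: connect1; rewrite e_sym xa in_setU1 xB orbT.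
  apply: (@connect_trans _ _ y); last by apply: connect1; rewrite yb in_setU1 eqxx.
  have /connectP[s sp ->] := xy.
  elim: s x xB sp {xa xy} => //= z s IHs x xB /andP[/and3P[xz _ zB0] zs].
  have zB := Bstep _ _ xB zB0 xz.
  apply: connect_trans (IHs z zB zs).
  by apply: connect1; rewrite xz in_setU1 zB orbT.
pose S' := B :|: Z.
have S'S : {subset S' <= S}.
  by move=> x; rewrite in_setU => /orP[/BB0|]; rewrite inE => /andP[].
have uS' : u \notin S'.
  rewrite in_setU negb_or; apply/andP; split; last by rewrite inE e_irr andbF.
  by apply/negP => /Bu[]; rewrite eqxx.
have S'N : #|S'| < N.
  apply: leq_trans (_ : #|S'| < #|S|) _; last by rewrite -ltnS.
  apply: proper_card; apply/properP; split; first exact/subsetP.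
  by exists u.
(* A vertex of [B] has no neighbour in [S] outside [S']: a neighbour also adjacent to [u] lies in
   [Z], any other lies in the component [B]. *)
have fin v : v \in B -> simplicial S' v ->
  exists v, [/\ v \in S, v != u, ~~ e u v & simplicial S v].
  move=> vB vs; exists v; have [vu nuv] := Bu v vB; split=> //.
    by apply: S'S; rewrite in_setU vB.
  have NE : [set w in S | e v w] \subset [set w in S' | e v w].
    apply/subsetP => w; rewrite inE => /andP[wS vw]; rewrite inE vw andbT in_setU.
    have wu : w != u by apply: contraNneq nuv => <-; rewrite e_sym.
    case: (boolP (e u w)) => uw.
      rewrite [in X in _ || X]inE wS uw (_ : [exists b in B, e b w]) ?orbT //.
      by apply/exists_inP; exists v.
    by rewrite (Bstep v) // inE wS wu.
  apply/forall_inP => x /(subsetP NE) xN; apply/forall_inP => y /(subsetP NE) yN.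
  by move/forall_inP: vs => /(_ x xN) /forall_inP /(_ y yN).
have S'case x : x \in S' -> (x \in B) || (x \in Z) by rewrite in_setU.
(* If some [z] in [Z] misses a vertex of [S'], the induction hypothesis at [z] returns a vertex not
   adjacent to [z], hence outside the clique [Z]. *)
case: (boolP [exists z in Z, [exists w in S', (w != z) && ~~ e z w]]).
  move=> /exists_inP[z zZ /exists_inP[w wS' /andP[wz nzw]]].
  have zS' : z \in S' by rewrite in_setU zZ orbT.
  have [v [vS' vz nzv vs]] := IH S' S'N z w zS' wS' wz nzw.
  apply: (fin v) => //.
  case/orP: (S'case v vS') => // vZ.
  by rewrite (Zadj z v) // eq_sym in nzv.
move=> noZ.
have Zuniv z w : z \in Z -> w \in S' -> w != z -> e z w.
  move=> zZ wS' wz; apply: contraNT noZ => nzw.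
  by apply/exists_inP; exists z => //; apply/exists_inP; exists w; rewrite ?wz.
(* Now every vertex of [Z] is adjacent to all others in [S'], so a vertex with a non-neighbour in
   [S'] lies in [B]; if [S'] is a clique, [w0] will do. *)
case: (boolP (clique e S')) => [cS'|].
  apply: (fin w0) => //.
  apply/forall_inP => x; rewrite inE => /andP[xS' _]; apply/forall_inP => y.
  rewrite inE => /andP[yS' _].
  by move/forall_inP: cS' => /(_ x xS') /forall_inP /(_ y yS').
rewrite negb_forall => /existsP[x]; rewrite negb_imply => /andP[xS'].
rewrite negb_forall => /existsP[y]; rewrite !negb_imply => /and3P[yS' xy nxy].
rewrite eq_sym in xy.
have [v [vS' vx nxv vs]] := IH S' S'N x y xS' yS' xy nxy.
apply: (fin v) => //.
case/orP: (S'case v vS') => // vZ.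
by rewrite e_sym (Zuniv v x) // eq_sym in nxv.
Qed.

(** In a clique every vertex is simplicial; otherwise two nonadjacent vertices feed the previous
    lemma. Having this for every subset [S] allows successive elimination without passing to induced
    subgraphs. *)
Lemma chordal_simplicial (S : {set T}) :
  S != set0 -> exists2 v, v \in S & simplicial S v.
Proof.
move=> /set0Pn[v vS]; case: (boolP (clique e S)) => [cS|].
  exists v => //; apply/forall_inP => x; rewrite inE => /andP[xS _].
  apply/forall_inP => y; rewrite inE => /andP[yS _].
  by move/forall_inP: cS => /(_ x xS) /forall_inP /(_ y yS).
rewrite negb_forall => /existsP[x]; rewrite negb_imply => /andP[xS].
rewrite negb_forall => /existsP[y]; rewrite !negb_imply => /and3P[yS xy nxy].
rewrite eq_sym in xy.
by have [w [wS _ _ ws]] := simplicial_nonneighbor xS yS xy nxy; exists w.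
Qed.
End Dirac.

Import Order.TTheory GRing.Theory Num.Theory.

Local Open Scope ring_scope.

(** * Positive semidefinite matrices with chordal sparsity *)

Definition quadform (R : pzRingType) (I : finType) (A : I -> I -> R) (z : I -> R) : R :=
  \sum_a \sum_b A a b * z a * z b.

Section PSD.
Variables (R : realFieldType) (I : finType).
Implicit Types (A : I -> I -> R) (z : I -> R).

Definition psd A := (forall a b, A a b = A b a) /\ (forall z, 0 <= quadform A z).

(** Along the basis vector of [v] the form is a quadratic polynomial in [c]; a suitable [c] yields
    each of the three facts on semidefinite matrices below. *)
Lemma quadform_shift A v c z : (forall a b, A a b = A b a) ->
  quadform A (fun a => z a + c * (a == v)%:R) =
  quadform A z + 2 * c * (\sum_a A v a * z a) + c ^+ 2 * A v v.
Proof.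
move=> Asym; rewrite /quadform.
have delta (f : I -> R) : \sum_a f a * (a == v)%:R = f v.
  rewrite (bigD1 v) //= eqxx mulr1 big1 ?addr0 // => a /negPf ->.
  by rewrite mulr0.
transitivity (\sum_a \sum_b A a b * z a * z b + \sum_a \sum_b c * A a b * z a * (b == v)%:R
  + (\sum_a (\sum_b c * A a b * z b) * (a == v)%:R
  + \sum_a (\sum_b c ^+ 2 * A a b * (b == v)%:R) * (a == v)%:R)).
  rewrite -!big_split; apply: eq_bigr => a _ /=.
  rewrite !mulr_suml -!big_split; apply: eq_bigr => b _ /=.
  by ring.
set S := \sum_a A v a * z a.
have -> : \sum_a \sum_b c * A a b * z a * (b == v)%:R = c * S.
  by rewrite mulr_sumr; apply: eq_bigr => a _; rewrite delta Asym mulrA.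
rewrite !delta.
have -> : \sum_b c * A v b * z b = c * S.
  by rewrite mulr_sumr; apply: eq_bigr => a _; rewrite mulrA.
by ring.
Qed.

Lemma psd_diag_ge0 A v : psd A -> 0 <= A v v.
Proof.
move=> [Asym /(_ (fun a => 0 + 1 * (a == v)%:R))].
rewrite quadform_shift // expr1n mul1r.
rewrite [quadform _ _]big1 ?add0r => [|a _]; last by rewrite big1 // => b _; rewrite mulr0.
by rewrite big1 ?mulr0 ?add0r // => a _; rewrite mulr0.
Qed.

(** With a zero diagonal entry the form is affine in the shift along [v], so a nonzero [A v a] would
    let it reach -1. *)
Lemma psd_diag_eq0 A v a : psd A -> A v v = 0 -> A v a = 0.
Proof.
move=> [Asym Apos] Avv; apply/eqP; apply: contraT => Ava.
pose q := quadform A (fun b => 0 + 1 * (b == a)%:R).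
have S : \sum_b A v b * (0 + 1 * (b == a)%:R) = A v a.
  rewrite (bigD1 a) //= eqxx mulr1 add0r mulr1 big1 ?addr0 // => b /negPf ->.
  by rewrite mulr0 addr0 mulr0.
have := Apos (fun b => (0 + 1 * (b == a)%:R) + (- (q + 1) / (2 * A v a)) * (b == v)%:R).
rewrite quadform_shift // S Avv mulr0 addr0 -/q.
rewrite (_ : 2 * _ * _ = - (q + 1)).
  by rewrite opprD addrA subrr add0r lerNr oppr0 ler10.
by rewrite mulrAC [2 * A v a * _]mulrC divfK // mulf_neq0 // pnatr_eq0.
Qed.

(** The Schur complement takes at [z] the minimum of the form of [A] over all shifts of [z] along
    [v], attained at [c = - s / A v v]. *)
Lemma psd_schur A v : psd A -> 0 < A v v ->
  psd (fun a b => A a b - A v a * A v b / A v v).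
Proof.
move=> [Asym Apos] Avv; split=> [a b|z]; first by rewrite Asym [A v a * _]mulrC.
set s := \sum_a A v a * z a.
have -> : quadform (fun a b => A a b - A v a * A v b / A v v) z =
          quadform A z - s ^+ 2 / A v v.
  rewrite expr2 {1}/s !mulr_suml -sumrB; apply: eq_bigr => a _.
  rewrite /s !mulr_sumr mulr_suml -sumrB; apply: eq_bigr => b _.
  by field; rewrite gt_eqF.
have := Apos (fun a => z a + (- s / A v v) * (a == v)%:R).
rewrite quadform_shift // -/s.
by congr (0 <= _); field; rewrite gt_eqF.
Qed.
End PSD.

(* The coordinate [None] is adjacent to every vertex and is eliminated last. *)
Lemma chordal_psd_decomposition (R : rcfType) (T : finType) (e : rel T)
    (e_sym : symmetric e) (e_irr : irreflexive e) (e_chordal : chordal e)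
    (A : option T -> option T -> R) (S : {set T}) :
  psd A ->
  (forall i b, i \notin S -> A (Some i) b = 0) ->
  (forall i j, A (Some i) (Some j) != 0 -> (i == j) || e i j) ->
  exists s : seq {ffun option T -> R},
    (forall a b, A a b = \sum_(f <- s) f a * f b) /\
    (forall f, f \in s -> clique e [set i | f (Some i) != 0]).
Proof.
elim: {S}_.+1 {-2}S (ltnSn #|S|) A => // N IH S SN A Apsd AS Ae.
have Asym := Apsd.1.
have [S0|Sn0] := eqVneq S set0.
  have A0 i b : A (Some i) b = 0 by apply: AS; rewrite S0 inE.
  exists [:: [ffun a => if a is Some _ then 0 else Num.sqrt (A None None)]]; split.
    move=> [i|] [j|]; rewrite big_seq1 !ffunE ?A0 ?mul0r // ?mulr0.
      by rewrite Asym.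
    by rewrite -expr2 sqr_sqrtr // psd_diag_ge0.
  move=> f; rewrite inE => /eqP ->; apply/forall_inP => i.
  by rewrite inE ffunE eqxx.
have [v vS vs] := chordal_simplicial e_sym e_irr e_chordal Sn0.
pose w := Some v.
have SvN : (#|S :\ v| < N)%N.
  by move: SN; rewrite (cardsD1 v S) vS.
(* A zero pivot forces a zero row, so [v] can simply be dropped; a positive one is removed by a
   Schur complement. *)
have := psd_diag_ge0 w Apsd; rewrite le_eqVlt => /orP[/eqP Avv|Avv].
  apply: (IH (S :\ v)) => // i b; rewrite in_setD1 negb_and negbK => /orP[/eqP ->|].
    exact: psd_diag_eq0.
  exact: AS.
have w0 : A w w != 0 by rewrite gt_eqF.
have Nadj i : A w (Some i) != 0 -> i != v -> i \in [set j in S | e v j].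
  move=> Ai iv; rewrite inE; apply/andP; split.
    by apply: contraNT Ai => iS; rewrite Asym AS.
  by have := Ae _ _ Ai; rewrite eq_sym (negPf iv).
have Ncl i j : i \in [set j in S | e v j] -> j \in [set j in S | e v j] -> i != j -> e i j.
  by move=> iN jN; move/forall_inP: vs => /(_ i iN) /forall_inP /(_ j jN) /implyP.
have [|i b|i j|s [sA scl]] := IH (S :\ v) SvN (fun a b => A a b - A w a * A w b / A w w).
- exact: psd_schur.
- rewrite in_setD1 negb_and negbK => /orP[/eqP ->|iS].
    by rewrite mulrAC divff // mul1r subrr.
  by rewrite (AS i) // (Asym w (Some i)) (AS i) // !mul0r subrr.
(* Fill-in at [(i, j)] needs both [i] and [j] adjacent to [v]; they are then adjacent to each other,
   as [v] is simplicial. *)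
- case: (eqVneq i j) => //= ij nz.
  have [Aij|/Ae] := eqVneq (A (Some i) (Some j)) 0; last by rewrite (negPf ij).
  have [iv|iv] := eqVneq i v.
    by move: nz; rewrite iv -/w mulrAC divff // mul1r subrr eqxx.
  have [jv|jv] := eqVneq j v.
    by move: nz; rewrite jv -/w mulfK // (Asym _ w) subrr eqxx.
  move: nz; rewrite Aij sub0r oppr_eq0 !mulf_eq0 !negb_or -andbA => /and3P[Ai Aj _].
  by apply: Ncl => //; apply: Nadj.
(* The rank-one part split off by the pivot; apart from [None] it lives on [v] and its neighbours in
   [S]. *)
pose f := [ffun a => A w a / Num.sqrt (A w w)].
exists (f :: s); split.
  move=> a b; rewrite big_cons -sA !ffunE.
  rewrite mulrACA -invfM -expr2 sqr_sqrtr ?ltW //.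
  by rewrite addrCA subrr addr0.
move=> g; rewrite inE => /orP[/eqP ->|/scl //].
apply/forall_inP => i; rewrite inE ffunE mulf_eq0 negb_or => /andP[Ai _].
apply/forall_inP => j; rewrite inE ffunE mulf_eq0 negb_or => /andP[Aj _].
apply/implyP => ij.
have [iv|iv] := eqVneq i v.
  by have := Ae _ _ Aj; rewrite -iv (negPf ij).
have [jv|jv] := eqVneq j v.
  by have := Ae _ _ Ai; rewrite e_sym eq_sym -jv (negPf ij).
by apply: Ncl => //; apply: Nadj.
Qed.

(** * Compactness *)

(** An inductive predicate gives continuity and bounds on boxes by induction, and confines the
    topology to one module. *)
Inductive polyfun (R : realType) (N : nat) : ('rV[R]_N -> R) -> Prop :=
| polyfun_coord i : polyfun (fun v => v ord0 i)
| polyfun_const c : polyfun (fun=> c)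
| polyfun_add f g : polyfun f -> polyfun g -> polyfun (fun v => f v + g v)
| polyfun_mul f g : polyfun f -> polyfun g -> polyfun (fun v => f v * g v).

(* The module keeps these imports local: their notations clash with those of
   mpoly, which is imported after it. *)
Module PolyfunCompact.
Import mathcomp_extra boolp classical_sets filter topology normedtype derive.
Import numFieldNormedType.Exports.
Local Open Scope classical_set_scope.

Lemma polyfun_continuous (R : realType) N (f : 'rV[R]_N -> R) :
  polyfun f -> continuous f.
Proof.
elim=> [i|c|g h _ cg _ ch|g h _ cg _ ch] v.
- exact: coord_continuous.
- exact: cst_continuous.
- by apply: continuousD; [exact: cg|exact: ch].
- by apply: continuousM; [exact: cg|exact: ch].
Qed.

(** The constraints cut a closed set out of a box; it is compact, so [f] attains its minimum there
    unless the set is empty. *)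
Lemma pos_lower_bound (R : realType) N (J : Type) (c : J -> 'rV[R]_N -> R)
    (f : 'rV[R]_N -> R) (B : R) :
  (forall j, polyfun (c j)) -> polyfun f ->
  (forall v : 'rV[R]_N, (forall i, `|v ord0 i| <= B) -> (forall j, c j v <= 0) ->
     0 < f v) ->
  exists2 dl, 0 < dl &
    forall v : 'rV[R]_N, (forall i, `|v ord0 i| <= B) -> (forall j, c j v <= 0) ->
     dl <= f v.
Proof.
move=> pc pf fpos.
pose A : set 'rV[R]_N :=
  [set v : 'rV[R]_N | (forall i, `|v ord0 i| <= B) /\ (forall j, c j v <= 0)].
have [A_0|A0] := eqVneq A set0.
  exists 1 => // v h1 h2.
  by have : A v by []; rewrite A_0.
have cA : compact A.
  apply: (@subclosed_compact _ _ [set v : 'rV[R]_N | forall i, `[- B, B]%classic (v ord0 i)]).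
  - rewrite (_ : A = (\bigcap_i [set v : 'rV[R]_N | `|v ord0 i| <= B]) `&`
        (\bigcap_j (c j @^-1` [set x : R | x <= 0]))).
      apply: closedI; apply: closed_bigI => i _.
        apply: (@preimage_closed _ _ (fun v : 'rV[R]_N => `|v ord0 i|)
          [set x : R | x <= B]); last exact: closed_le.
        move=> v _; apply: continuous_comp; last exact: norm_continuous.
        exact: coord_continuous.
      apply: preimage_closed; last exact: closed_le.
      by move=> v _; exact: polyfun_continuous.
    by apply/seteqP; split=> v [h1 h2]; split=> // i;
      by [move=> _; exact: h1|move=> _; exact: h2|exact: h1|exact: h2].
  - by apply: (@rV_compact R N (fun=> `[- B, B]%classic)) => i; exact: segment_compact.
  - move=> v [h _] i /=; have := h i.
    by rewrite ler_norml in_itv.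
have [||v vA vmin] := @EVT_min_rV R N f A _ cA.
- by apply/set0P.
- by apply: continuous_subspaceT => v; exact: polyfun_continuous.
exists (f v).
  by case: (set_mem vA) => h1 h2; exact: fpos.
by move=> u h1 h2; apply: vmin; apply/mem_set.
Qed.
End PolyfunCompact.

Lemma polyfun_bounded (R : realType) N (f : 'rV[R]_N -> R) (B : R) :
  polyfun f ->
  exists Bf, forall v : 'rV[R]_N, (forall i, `|v ord0 i| <= B) -> `|f v| <= Bf.
Proof.
elim=> [i|c|g h _ [Bg hg] _ [Bh hh]|g h _ [Bg hg] _ [Bh hh]].
- by exists B => v /(_ i).
- by exists `|c|.
- exists (Bg + Bh) => v vB.
  by apply: le_trans (ler_normD _ _) _; apply: lerD; [exact: hg|exact: hh].
- exists (Bg * Bh) => v vB; rewrite normrM.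
  by apply: ler_pM => //; [exact: hg|exact: hh].
Qed.

(** Where [f <= 0] the penalty [g] cannot vanish, so compactness bounds it away from 0 there, and a
    large [lam] outweighs [f]. *)
Lemma penalty_lower_bound (R : realType) N (J : Type)
    (c : J -> 'rV[R]_N -> R) (f g : 'rV[R]_N -> R) (B : R) :
  (forall j, polyfun (c j)) -> polyfun f -> polyfun g ->
  (forall v, 0 <= g v) ->
  (forall v : 'rV[R]_N, (forall i, `|v ord0 i| <= B) -> (forall j, c j v <= 0) ->
     g v = 0 -> 0 < f v) ->
  exists lam, exists2 dl, 0 < dl &
    forall v : 'rV[R]_N, (forall i, `|v ord0 i| <= B) -> (forall j, c j v <= 0) ->
     dl <= f v + lam * g v.
Proof.
move=> pc pf pg g0 fpos.
pose c' (j : option J) := if j is Some j then c j else f.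
have pc' j : polyfun (c' j) by case: j => [j|] /=.
have [|e e0 ge] := @PolyfunCompact.pos_lower_bound R N _ c' g B pc' pg.
  move=> v vB vc; rewrite lt_def g0 andbT; apply/eqP => gv.
  have := fpos v vB (fun j => vc (Some j)) gv.
  by rewrite ltNge (vc None).
have [Bf fB] := @polyfun_bounded R N f B pf.
(* Chosen so that [lam * e] exceeds the bound on [f] by at least 1. *)
pose lam := (`|Bf| + 1) / e.
have lam0 : 0 < lam by apply: divr_gt0 => //; rewrite ltr_wpDl.
have ph : polyfun (fun v => f v + lam * g v).
  by apply: polyfun_add => //; apply: polyfun_mul => //; apply: polyfun_const.
have [|dl dl0 hdl] := @PolyfunCompact.pos_lower_bound R N _ c _ B pc ph.
  move=> v vB vc; case: (ltP 0 (f v)) => [f0|f0].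
    by apply: ltr_wpDr => //; apply: mulr_ge0 => //; exact: ltW.
  have gv : e <= g v by apply: ge => // -[j|] /=.
  apply: (@lt_le_trans _ _ (f v + lam * e)); last by rewrite lerD2l ler_pM2l.
  rewrite /lam divfK ?gt_eqF // -ltrBlDl sub0r.
  apply: (@le_lt_trans _ _ `|Bf|); last by rewrite ltrDl.
  apply: le_trans (ler_norm _); apply: le_trans (fB v vB).
  by rewrite -normrN ler_norm.
by exists lam, dl.
Qed.

From mathcomp Require Import mpoly.

(** * Polya's theorem for matrices of forms *)

Lemma mnm_word k D (g : 'X_{1..k}) : mdeg g = D ->
  exists v : {ffun 'I_D -> 'I_k}, (\sum_i U_(v i))%MM = g.
Proof.
elim: D g => [|D IH] g gD.
  case: k g gD => [|k] g gD.
    have v : 'I_0 -> 'I_0 by [].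
    by exists (finfun v); rewrite big_ord0; apply/mnmP => -[].
  exists [ffun=> ord0]; rewrite big_ord0; apply/esym/eqP.
  by rewrite -mdeg_eq0 gD.
have [j gj] : exists j, g j != 0%N.
  apply/existsP; apply: contra_eqT gD; rewrite negb_exists => /forallP g0.
  by rewrite mdegE big1 // => j _; apply/eqP; have := g0 j; rewrite negbK.
have Ug : (U_(j) <= g)%MM by rewrite lep1mP.
have [|v vE] := IH (g - U_(j))%MM.
  by apply/eqP; rewrite -(eqn_add2r 1) -{1}(mdeg1 j) -mdegD submK // gD addn1.
exists [ffun i => if unlift ord0 i is Some i' then v i' else j].
rewrite big_ord_recl ffunE unlift_none.
rewrite (eq_bigr (fun i => U_(v i)%MM)); last by move=> i _; rewrite ffunE liftK.
by rewrite vE addmC submK.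
Qed.

Section Words.
Variables (R : realFieldType) (k D : nat).

(* The coefficient of a monomial is shared equally by the words spelling it, so
   that it depends only on the polynomial. *)
Definition word_coeff (p : {mpoly R[k]}) (v : {ffun 'I_D -> 'I_k}) : R :=
  let g := (\sum_i U_(v i))%MM in
  p@_g / #|[set v' : {ffun 'I_D -> 'I_k} | (\sum_i U_(v' i))%MM == g]|%:R.

Lemma dhomog_words p : p \is D.-homog ->
  p = \sum_v word_coeff p v *: \prod_i 'X_(v i).
Proof.
move=> pD; have XE (v : {ffun 'I_D -> 'I_k}) :
    \prod_i 'X_(v i) = 'X_[R, (\sum_i U_(v i))%MM] by rewrite -mprodXE.
apply/mpolyP => g; rewrite linear_sum /=.
under eq_bigr => v _.
  rewrite XE mcoeffZ mcoeffX.
  rewrite mulr_natr mulrb.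
  over.
rewrite -big_mkcond /=.
set s := [set v' : {ffun 'I_D -> 'I_k} | (\sum_i U_(v' i))%MM == g].
rewrite (eq_bigr (fun=> p@_g / #|s|%:R)); last first.
  by move=> v /eqP vg; rewrite /word_coeff /= vg.
rewrite (eq_bigl (fun v => v \in s)); last by move=> v; rewrite inE.
rewrite sumr_const -(mulr_natr (_ / _)).
have [/eqP s0|s0] := eqVneq s set0.
  rewrite -cards_eq0 in s0; rewrite (eqP s0) mulr0.
  apply: dhomog_nemf_coeff pD _; apply: contraTneq s0 => /mnm_word[v vg].
  by rewrite cards_eq0; apply/set0Pn; exists v; rewrite inE vg.
by rewrite divfK // pnatr_eq0 cards_eq0.
Qed.

Lemma word_coeff0 v : word_coeff 0 v = 0.
Proof. by rewrite /word_coeff mcoeff0 mul0r. Qed.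

Definition word_comp N (w : {ffun 'I_N -> 'I_k}) (i : {ffun 'I_D -> 'I_N}) :
  {ffun 'I_D -> 'I_k} := [ffun j => w (i j)].

(** Among the words [w] that spell a given [v] at the positions [i], the other [N - D] letters are
    free and sum to a power of the sum of the variables; injectivity of [i] keeps the prescribed
    letters from clashing. *)
Lemma sum_words_inj N (h : {ffun 'I_D -> 'I_k} -> R) (i : {ffun 'I_D -> 'I_N}) :
  injective i ->
  \sum_(w : {ffun 'I_N -> 'I_k}) h (word_comp w i) *: \prod_j 'X_(w j) =
  (\sum_l 'X_l) ^+ (N - D) * \sum_v h v *: \prod_j 'X_(v j) :> {mpoly R[k]}.
Proof.
move=> inj.
rewrite (partition_big (fun w => word_comp w i) xpredT) //= mulr_sumr.
apply: eq_bigr => v _.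
rewrite (eq_bigr (fun w : {ffun 'I_N -> 'I_k} => h v *: \prod_j 'X_(w j))); last first.
  by move=> w /eqP ->.
rewrite -scaler_sumr -scalerAr; congr (_ *: _).
pose Q (j : 'I_N) : pred 'I_k := fun l => [forall j', (i j' == j) ==> (l == v j')].
rewrite (eq_bigl (fun w => w \in family Q)); last first.
  move=> w; apply/eqP/familyP => [wv j|wQ].
    apply/forallP => j'; apply/implyP => /eqP <-.
    by rewrite -wv ffunE.
  apply/ffunP => j; rewrite ffunE; apply/eqP.
  by have /forallP /(_ j) := wQ (i j); rewrite eqxx.
rewrite -(bigA_distr_big_dep _ (fun _ l => 'X_l)) /=.
rewrite (bigID (fun j => j \in codom i)) /= mulrC; congr (_ * _).
  rewrite (eq_bigr (fun=> \sum_l 'X_l)); last first.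
    move=> j jn; apply: eq_bigl => l; apply/forallP => j'; apply/implyP => /eqP ij.
    by rewrite -ij codom_f in jn.
  rewrite prodr_const; congr (_ ^+ _).
  have NE : (D + #|[predC codom i]|)%N = N.
    by rewrite -[RHS]card_ord -(cardC (mem (codom i))) card_codom // card_ord.
  by move/(congr1 (subn^~ D)): NE; rewrite addKn => <-.
rewrite -big_uniq; last by rewrite codomE map_inj_uniq ?enum_uniq.
rewrite codomE big_map big_enum /=.
apply: eq_bigr => j _; rewrite (big_pred1 (v j)) // => l.
apply/forallP/eqP => [/(_ j)|-> j']; first by rewrite eqxx => /eqP.
by apply/implyP => /eqP /inj ->.
Qed.

(** The numerator of a product of [D] frequencies counts the maps [i] along which [w] spells [v], so
    the value is an average over all maps, injective or not. *)
Lemma meval_words_freq N (h : {ffun 'I_D -> 'I_k} -> R) (w : {ffun 'I_N -> 'I_k}) :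
  (\sum_v h v *: \prod_j 'X_(v j)).@[fun l => (\sum_j (w j == l)%:R) / N%:R] =
  (\sum_i h (word_comp w i)) / (N ^ D)%:R.
Proof.
rewrite [LHS]linear_sum /= (partition_big (word_comp w) xpredT) //= mulr_suml.
apply: eq_bigr => v _; rewrite mevalZ rmorph_prod /=.
under eq_bigr do rewrite mevalXU.
rewrite prodf_div prodr_const card_ord -natrX mulrA; congr (_ / _).
rewrite bigA_distr_bigA mulr_sumr [RHS]big_mkcond; apply: eq_bigr => i _.
case: eqP => [<-|ne].
  by rewrite big1 ?mulr1 // => j _; rewrite ffunE eqxx.
have [j jn] : exists j, w (i j) != v j.
  apply/existsP; apply: contra_notT ne; rewrite negb_exists => /forallP wv.
  by apply/ffunP => j; rewrite ffunE; apply/eqP; have := wv j; rewrite negbK.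
by rewrite (bigD1 j) //= (negPf jn) mul0r mulr0.
Qed.
End Words.

Lemma leq_ffact_expn (N D : nat) : (N ^_ D <= N ^ D)%N.
Proof.
elim: D => [|D IH]; first by rewrite ffactn0.
by rewrite ffactnSr expnSr leq_mul // leq_subr.
Qed.

(** The bound [D ^ 2 / N] on the share of non-injective maps from [D] to [N] points, cleared of
    denominators. *)
Lemma expn_ffact_bound (N D : nat) : (N ^ D * N <= N ^_ D * N + D ^ 2 * N ^ D)%N.
Proof.
elim: D => [|D IH]; first by rewrite expn0 ffactn0 leq_addr.
have h1 := leq_mul IH (leqnn N).
have h2 : (N ^_ D * N <= N ^_ D * (N - D) + N ^ D * D)%N.
  apply: (@leq_trans (N ^_ D * (N - D) + N ^_ D * D)).
    by rewrite -mulnDr leq_mul2l addnC -leq_subLR leqnn orbT.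
  by rewrite leq_add2l leq_mul2r leq_ffact_expn orbT.
have h3 := leq_mul h2 (leqnn N).
rewrite ffactnSr expnSr; apply: leq_trans h1 _; rewrite mulnDl.
apply: leq_trans (leq_add h3 (leqnn _)) _; rewrite mulnDl -addnA leq_add2l.
have -> : (D.+1 ^ 2 * (N ^ D * N) =
  N ^ D * D * N + D ^ 2 * N ^ D * N + D.+1 * (N ^ D * N))%N by ring.
exact: leq_addr.
Qed.

Section Quadform.
Variables (R : realFieldType) (I : finType).

Lemma quadform_sum (J : finType) (P : pred J) (A : J -> I -> I -> R) z :
  quadform (fun a b => \sum_(j | P j) A j a b) z =
  \sum_(j | P j) quadform (A j) z.
Proof.
rewrite /quadform [RHS]exchange_big; apply: eq_bigr => a _ /=.
rewrite [RHS]exchange_big; apply: eq_bigr => b _ /=.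
by rewrite !mulr_suml.
Qed.

Lemma quadformZ c (A : I -> I -> R) z :
  quadform (fun a b => c * A a b) z = c * quadform A z.
Proof.
rewrite /quadform mulr_sumr; apply: eq_bigr => a _.
by rewrite mulr_sumr; apply: eq_bigr => b _; rewrite !mulrA.
Qed.

Lemma eq_quadform (A B : I -> I -> R) z : (forall a b, A a b = B a b) ->
  quadform A z = quadform B z.
Proof. by move=> AB; apply: eq_bigr => a _; apply: eq_bigr => b _; rewrite AB. Qed.

Lemma quadform_norm_le (A : I -> I -> R) z :
  quadform A z <= (\sum_a \sum_b `|A a b|) * \sum_a z a ^+ 2.
Proof.
rewrite mulr_suml; apply: ler_sum => a _.
rewrite mulr_suml; apply: ler_sum => b _.
apply: le_trans (ler_norm _) _; rewrite -mulrA normrM ler_wpM2l //.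
have sq c : z c ^+ 2 <= \sum_a z a ^+ 2.
  by rewrite (bigD1 c) //= lerDl sumr_ge0 // => ? _; rewrite sqr_ge0.
have sa := sq a; have sb := sq b; set s := \sum_a _ in sa sb *.
have h1 : 0 <= (z a - z b) ^+ 2 by rewrite sqr_ge0.
have h2 : 0 <= (z a + z b) ^+ 2 by rewrite sqr_ge0.
by rewrite ler_norml; apply/andP; split; lra.
Qed.
End Quadform.

(* The coefficient of a word [w] of length [N] is the average of the
   coefficients of its subwords [w o i] over injections [i]. The average over all
   maps [i] is the value of [G] at the letter frequencies of [w], and a map fails
   to be injective with probability O(1/N). *)
Lemma matrix_polya (R : archiRealFieldType) (k D : nat) (I : finType)
    (G : I -> I -> {mpoly R[k]}) (dl : R) :
  0 < dl -> (forall a b, G a b \is D.-homog) ->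
  (forall a b, G a b = G b a) ->
  (forall (t : 'I_k -> R) (z : I -> R), (forall l, 0 <= t l) -> \sum_l t l = 1 ->
     dl * (\sum_a z a ^+ 2) <= quadform (fun a b => (G a b).@[t]) z) ->
  exists M N (A : {ffun 'I_N -> 'I_k} -> I -> I -> R),
    [/\ forall w, psd (A w),
        forall w a b, G a b = 0 -> A w a b = 0 &
        forall a b, (\sum_l 'X_l) ^+ M * G a b = \sum_w A w a b *: \prod_j 'X_(w j)].
Proof.
move=> dl0 GD Gsym Gpos.
pose h a b := word_coeff (D := D) (G a b).
pose Bd : R := \sum_v \sum_a \sum_b `|h a b v|.
have Bd0 : 0 <= Bd by do 3 (apply: sumr_ge0 => ? _).
(* With [N] this large the non-injective maps, a share of at most [D ^ 2 / N] with terms bounded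
   through [Bd], cannot use up the margin [dl]; [D <= N] makes injections exist. *)
pose N := (Num.bound ((D ^ 2)%:R * Bd / dl) + D).+1.
have Nbig : (D ^ 2)%:R * Bd <= N%:R * dl.
  rewrite -ler_pdivrMr //; apply: ltW; apply: lt_le_trans (archi_boundP _) _.
    by apply: divr_ge0; [apply: mulr_ge0|exact: ltW].
  by rewrite ler_nat /N -addSn addSnnS leq_addr.
have DN : (D <= N)%N by rewrite /N; apply: leqW; exact: leq_addl.
pose injs : pred {ffun 'I_D -> 'I_N} := fun i => injectiveb i.
have cinj : #|injs| = (N ^_ D)%N.
  have := card_inj_ffuns 'I_D 'I_N; rewrite !card_ord => <-.
  by apply: eq_card => i; rewrite !inE.
have inj0 : (0 < (N ^_ D)%:R :> R) by rewrite ltr0n ffact_gt0.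
exists (N - D)%N, N, (fun w a b => (N ^_ D)%:R^-1 * \sum_(i | injs i) h a b (word_comp w i)).
split.
- move=> w; split=> [a b|z].
    by congr (_ * _); apply: eq_bigr => i _; rewrite /h Gsym.
  rewrite quadformZ quadform_sum; apply: mulr_ge0; first by rewrite invr_ge0 ltW.
  pose Q v := quadform (fun a b => h a b v) z.
  pose S := \sum_a z a ^+ 2.
  have S0 : 0 <= S by apply: sumr_ge0 => ? _; rewrite sqr_ge0.
  have Qle v : Q v <= Bd * S.
    apply: le_trans (quadform_norm_le _ _) _; rewrite ler_wpM2r //.
    rewrite /Bd (bigD1 v) //= lerDl; apply: sumr_ge0 => ? _.
    by do 2 (apply: sumr_ge0 => ? _).
  have N0 : 0 < N%:R :> R by rewrite ltr0n.
  (* The letter frequencies of [w] form a point of the simplex, where the lower bound on [G]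
     applies. *)
  have tot : (N ^ D)%:R * (dl * S) <= \sum_i Q (word_comp w i).
    pose t (l : 'I_k) : R := (\sum_j (w j == l)%:R) / N%:R.
    have := Gpos t z; rewrite -/S.
    have -> : quadform (fun a b => (G a b).@[t]) z =
              (N ^ D)%:R^-1 * \sum_i Q (word_comp w i).
      rewrite -[in RHS]quadform_sum -quadformZ; apply: eq_quadform => a b.
      by rewrite {1}(dhomog_words (GD a b)) meval_words_freq mulrC.
    rewrite ler_pdivlMl; last by rewrite natrX exprn_gt0.
    apply.
      by move=> l; apply: divr_ge0 => //; apply: sumr_ge0.
    rewrite /t -mulr_suml exchange_big /= (eq_bigr (fun=> 1)).
      by rewrite sumr_const card_ord divff // gt_eqF.
    by move=> j _; rewrite (bigD1 (w j)) //= eqxx big1 ?addr0 // => l /negPf; rewrite eq_sym => ->.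
  have nin : \sum_(i | ~~ injs i) Q (word_comp w i) <= ((N ^ D)%:R - (N ^_ D)%:R) * (Bd * S).
    apply: le_trans (ler_sum _ (fun i _ => Qle _)) _.
    rewrite sumr_const -(mulr_natl (Bd * S)).
    rewrite (_ : (N ^ D)%:R - (N ^_ D)%:R = #|[predC injs]|%:R :> R) //.
    have := cardC injs; rewrite cinj card_ffun !card_ord => <-.
    by rewrite natrD addrC addKr.
  have := expn_ffact_bound N D; rewrite -(ler_nat R) natrD !natrM => bnd.
  rewrite (bigID injs) /= in tot.
  have lo : (N ^ D)%:R * (dl * S) - ((N ^ D)%:R - (N ^_ D)%:R) * (Bd * S) <=
            \sum_(i | injs i) Q (word_comp w i).
    by rewrite lerBlDr; apply: le_trans tot _; rewrite lerD2l.
  apply: le_trans lo.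
  rewrite -(pmulr_rge0 _ N0) mulrBr subr_ge0.
  have ND0 : 0 <= (N ^ D)%:R :> R by [].
  apply: (@le_trans _ _ (((D ^ 2)%:R * (N ^ D)%:R) * (Bd * S))).
    by rewrite [leLHS]mulrA ler_wpM2r ?mulr_ge0 //; lra.
  have := ler_wpM2r (mulr_ge0 ND0 S0) Nbig.
  by congr (_ <= _); ring.
- move=> w a b G0; rewrite big1 ?mulr0 // => i _.
  by rewrite /h G0 word_coeff0.
- move=> a b.
  apply/esym; under eq_bigr do rewrite -scalerA scaler_suml.
  rewrite -scaler_sumr exchange_big /=.
  rewrite (eq_bigr (fun=> (\sum_l 'X_l) ^+ (N - D) * G a b)); last first.
    by move=> i /injectiveP iinj; rewrite sum_words_inj // -dhomog_words.
  by rewrite sumr_const -scaler_nat scalerA cinj mulVf ?scale1r // gt_eqF.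
Qed.

(** * Forms in x as forms in the squares of x_i + x_j and x_i - x_j *)

Section Lifting.
Variables (R : rcfType) (n : nat).

Local Notation pm := ('I_n * 'I_n * bool)%type.
Local Notation K := #|{: pm}|.

(* The index [(i, j, b)] stands for [x_i + x_j] if [b] is false and for
   [x_i - x_j] if [b] is true. *)
Definition pm_form (c : pm) : {mpoly R[n]} :=
  'X_(c.1.1) + (if c.2 then - 'X_(c.1.2) else 'X_(c.1.2)).

Definition pm_squares : K.-tuple {mpoly R[n]} :=
  [tuple pm_form (enum_val l) ^+ 2 | l < K].

Local Notation subst_squares := (comp_mpoly pm_squares).

Definition pm_var (c : pm) : {mpoly R[K]} := 'X_(enum_rank c).

(* Becomes [4 x_i x_j] under [subst_squares]. *)
Definition prod_var i j := pm_var (i, j, false) - pm_var (i, j, true).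

(** The identity [4 (x_i +- x_j)^2 = 4 x_i^2 + 4 x_j^2 +- 8 x_i x_j], read through the
    substitution. *)
Definition linear_relation i j b :=
  pm_var (i, j, b) *+ 4 -
  (prod_var i i + prod_var j j + (if b then - prod_var i j else prod_var i j) *+ 2).

(** Up to symmetry of the indices, a 2 x 2 minor of the matrix of the [prod_var i j] through a
    diagonal entry. *)
Definition rank1_relation i j l :=
  prod_var i i * prod_var j l - prod_var i j * prod_var i l.

Definition var_sum : {mpoly R[K]} := \sum_l 'X_l.

(** The factor [var_sum ^+ 2], equal to 1 on the simplex, brings the squared linear relations to the
    degree 4 of the squared minors. *)
Definition penalty : {mpoly R[K]} :=
  (\sum_i \sum_j \sum_b linear_relation i j b ^+ 2) * var_sum ^+ 2 +
  \sum_i \sum_j \sum_l rank1_relation i j l ^+ 2.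

Lemma subst_pm_var c : subst_squares (pm_var c) = pm_form c ^+ 2.
Proof.
by rewrite comp_mpolyXU -tnth_nth tnth_mktuple enum_rankK.
Qed.

Lemma subst_prod_var i j : subst_squares (prod_var i j) = 'X_i * 'X_j *+ 4.
Proof. by rewrite rmorphB /= !subst_pm_var /pm_form /=; ring. Qed.

Lemma subst_penalty : subst_squares penalty = 0.
Proof.
rewrite rmorphD rmorphM /= [X in X * _](_ : _ = 0) ?mul0r ?add0r; last first.
  rewrite rmorph_sum big1 // => i _; rewrite rmorph_sum big1 // => j _.
  rewrite rmorph_sum big1 // => b _; rewrite rmorphXn /= rmorphB rmorphMn /=.
  rewrite 2!rmorphD rmorphMn /= !subst_prod_var subst_pm_var /pm_form /=.
  by case: b; rewrite ?rmorphN /= !subst_prod_var; ring.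
rewrite rmorph_sum big1 // => i _; rewrite rmorph_sum big1 // => j _.
rewrite rmorph_sum big1 // => l _; rewrite rmorphXn rmorphB !rmorphM /=.
by rewrite !subst_prod_var; ring.
Qed.

Lemma sum_pm (V : nmodType) (F : pm -> V) :
  \sum_(l < K) F (enum_val l) = \sum_i \sum_j \sum_b F (i, j, b).
Proof.
rewrite pair_bigA (pair_bigA _ (fun c b => F (c.1, c.2, b))) /=.
rewrite (reindex enum_rank) /=; last exact/onW_bij/enum_rank_bij.
by apply: eq_bigr => -[[i j] b] _; rewrite enum_rankK.
Qed.

(** The two signs add up to [2 x_i^2 + 2 x_j^2], which is summed over all ordered pairs, including
    [i = j]. *)
Lemma subst_var_sum :
  subst_squares var_sum = (\sum_i 'X_i ^+ 2) *+ (4 * n).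
Proof.
have XE l : subst_squares 'X_l = pm_form (enum_val l) ^+ 2.
  by rewrite -subst_pm_var /pm_var enum_valK.
rewrite rmorph_sum /= (eq_bigr _ (fun l _ => XE l)).
rewrite (sum_pm (fun c => pm_form c ^+ 2)).
transitivity (\sum_(i < n) \sum_(j < n) ('X_i ^+ 2 *+ 2 + 'X_j ^+ 2 *+ 2) : {mpoly R[n]}).
  apply: eq_bigr => i _; apply: eq_bigr => j _.
  by rewrite big_bool /pm_form /=; ring.
transitivity (\sum_(i < n) ('X_i ^+ 2 *+ 2 *+ n + (\sum_(j < n) 'X_j ^+ 2) *+ 2) : {mpoly R[n]}).
  by apply: eq_bigr => i _; rewrite big_split /= sumr_const card_ord sumrMnl.
rewrite big_split /= sumr_const card_ord !sumrMnl -!mulrnA -mulrnDr.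
by rewrite -mulnDl.
Qed.

Lemma dhomog_pm_var c : pm_var c \is 1.-homog.
Proof. by rewrite dhomogX; apply/eqP; exact: mdeg1. Qed.

Lemma dhomog_prod_var i j : prod_var i j \is 1.-homog.
Proof. by apply: rpredB; apply: dhomog_pm_var. Qed.

Lemma dhomog_var_sum : var_sum \is 1.-homog.
Proof. by apply: rpred_sum => l _; rewrite dhomogX; apply/eqP; exact: mdeg1. Qed.

Lemma dhomog_penalty : penalty \is 4.-homog.
Proof.
apply: rpredD.
  apply: (@dhomogM _ _ _ 2 _ 2); last exact: (dhomogMn 2 dhomog_var_sum).
  apply: rpred_sum => i _; apply: rpred_sum => j _; apply: rpred_sum => b _.
  apply: (@dhomogMn _ _ _ 1 _ 2); apply: rpredB; first exact/rpredMn/dhomog_pm_var.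
  apply: rpredD; first by apply: rpredD; apply: dhomog_prod_var.
  by apply: rpredMn; case: b; rewrite ?rpredN dhomog_prod_var.
apply: rpred_sum => i _; apply: rpred_sum => j _; apply: rpred_sum => l _.
apply: (@dhomogMn _ _ _ 2 _ 2); apply: rpredB;
  by apply: (@dhomogM _ _ _ 1 _ 1); apply: dhomog_prod_var.
Qed.

Lemma meval_penalty_ge0 t : 0 <= penalty.@[t].
Proof.
rewrite mevalD mevalM; apply: addr_ge0; first apply: mulr_ge0.
- by rewrite rmorph_sum sumr_ge0 // => i _; rewrite rmorph_sum sumr_ge0 // => j _;
    rewrite rmorph_sum sumr_ge0 // => b _; rewrite rmorphXn sqr_ge0.
- by rewrite rmorphXn sqr_ge0.
- by rewrite rmorph_sum sumr_ge0 // => i _; rewrite rmorph_sum sumr_ge0 // => j _;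
    rewrite rmorph_sum sumr_ge0 // => b _; rewrite rmorphXn sqr_ge0.
Qed.

(** At a zero on the simplex all relations hold, so the numbers [y i j] form a rank-one matrix with
    a positive diagonal entry, from which [x] is read off. *)
Lemma penalty_eq0 (t : 'I_K -> R) :
  (forall l, 0 <= t l) -> \sum_l t l = 1 -> penalty.@[t] = 0 ->
  exists2 x : 'I_n -> R, (exists i, x i != 0) &
    forall l, t l = (pm_form (enum_val l) ^+ 2).@[x].
Proof.
move=> t0 t1 Pt.
have sumsq0 (A1 A2 A3 : finType) (F : A1 -> A2 -> A3 -> R) :
    \sum_i \sum_j \sum_l F i j l ^+ 2 = 0 -> forall i j l, F i j l = 0.
  move=> /eqP; rewrite psumr_eq0 => [/allP h i j l|i _]; last first.
    by apply: sumr_ge0 => j _; apply: sumr_ge0 => l _; rewrite sqr_ge0.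
  have /eqP := h i (mem_index_enum _) => /eqP.
  rewrite psumr_eq0 => [/allP h'|j' _]; last by apply: sumr_ge0 => l' _; rewrite sqr_ge0.
  have := h' j (mem_index_enum _) => /=.
  rewrite psumr_eq0 => [/allP h''|l' _]; last by rewrite sqr_ge0.
  by have := h'' l (mem_index_enum _); rewrite /= sqrf_eq0 => /eqP.
pose u c := t (enum_rank c).
pose y i j := u (i, j, false) - u (i, j, true).
have yE i j : (prod_var i j).@[t] = y i j by rewrite mevalB !mevalXU.
have u0 c : 0 <= u c by exact: t0.
have Pt1 : \sum_i \sum_j \sum_b (linear_relation i j b).@[t] ^+ 2 = 0 /\
           \sum_i \sum_j \sum_l (rank1_relation i j l).@[t] ^+ 2 = 0.
  move: Pt; rewrite mevalD mevalM rmorphXn /=.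
  rewrite [var_sum.@[t]]rmorph_sum /= (eq_bigr t); last by move=> l _; rewrite mevalXU.
  rewrite t1 expr1n mulr1.
  have sumE (A1 A2 A3 : finType) (F : A1 -> A2 -> A3 -> {mpoly R[K]}) :
      (\sum_i \sum_j \sum_l F i j l ^+ 2).@[t] = \sum_i \sum_j \sum_l (F i j l).@[t] ^+ 2.
    rewrite rmorph_sum; apply: eq_bigr => i _; rewrite rmorph_sum; apply: eq_bigr => j _.
    by rewrite rmorph_sum; apply: eq_bigr => l _; rewrite rmorphXn.
  have s0 (A1 A2 A3 : finType) (F : A1 -> A2 -> A3 -> R) : 0 <= \sum_i \sum_j \sum_l F i j l ^+ 2.
    by apply: sumr_ge0 => i _; apply: sumr_ge0 => j _; apply: sumr_ge0 => l _; rewrite sqr_ge0.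
  rewrite !sumE => /eqP; rewrite paddr_eq0 //.
  by move=> /andP[/eqP h1 /eqP h2].
have lin i j b : u (i, j, b) *+ 4 = y i i + y j j + (if b then - y i j else y i j) *+ 2.
  have := sumsq0 _ _ _ _ Pt1.1 i j b; rewrite mevalB mevalMn mevalXU 2!mevalD mevalMn !yE.
  by move=> /eqP; rewrite subr_eq0 => /eqP ->; case: b; rewrite ?mevalN yE.
have rk1 i j l : y i i * y j l = y i j * y i l.
  have := sumsq0 _ _ _ _ Pt1.2 i j l; rewrite mevalB !mevalM !yE.
  by move=> /eqP; rewrite subr_eq0 => /eqP.
have yii i : u (i, i, true) = 0 by have := lin i i true; lra.
have yii0 i : 0 <= y i i by rewrite /y yii subr0.
(* If the diagonal vanished, the linear relations would make [u (i, j, false)] and [u (i, j, true)]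
   opposite; being nonnegative, all would be 0, against the sum 1. *)
have [i0 yi0] : exists i, 0 < y i i.
  apply/existsP; apply: contra_eqT t1; rewrite negb_exists => /forallP ny.
  have y0 i : y i i = 0 by apply: le_anti; rewrite yii0 andbT leNgt ny.
  suff -> : \sum_l t l = 0 by rewrite eq_sym oner_eq0.
  apply: big1 => l _.
  rewrite -[l]enum_valK; case: (enum_val l) => [[i j] b].
  have := lin i j true; have := lin i j false; rewrite !y0 -/(u _).
  have := u0 (i, j, true); have := u0 (i, j, false).
  by case: b; lra.
pose s := Num.sqrt (y i0 i0).
have s0 : 0 < s by rewrite sqrtr_gt0.
have s2 : s ^+ 2 = y i0 i0 by rewrite sqr_sqrtr.
(* Row [i0] of the matrix, scaled so that [4 x_j x_l = y j l]. *)
pose x j := y i0 j / (2 * s).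
have xx j l : x j * x l = y j l / 4.
  apply: (mulfI (lt0r_neq0 yi0)); rewrite [RHS]mulrA rk1 -s2 /x.
  by field; rewrite gt_eqF.
exists x.
  by exists i0; rewrite /x mulf_neq0 ?invr_eq0 ?mulf_neq0 ?pnatr_eq0 ?lt0r_neq0.
move=> l; rewrite -{1}[l]enum_valK; case: (enum_val l) => [[i j] b].
rewrite -/(u _) /pm_form /= rmorphXn /= mevalD.
have -> : u (i, j, b) = (x i * x i + x j * x j + (if b then - (x i * x j) else x i * x j) *+ 2).
  by rewrite !xx; have := lin i j b; case: b; lra.
by case: b; rewrite ?mevalN !mevalXU; ring.
Qed.

(** The word of the monomial is cut into pairs of letters, each pair [x_i x_j] being the image of
    [prod_var i j] divided by 4. *)
Lemma lift_monomial d (g : 'X_{1..n}) : mdeg g = (2 * d)%N ->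
  exists2 F : {mpoly R[K]}, F \is d.-homog & subst_squares F = 'X_[g].
Proof.
elim: d g => [|d IH] g.
  move=> /eqP; rewrite mdeg_eq0 => /eqP ->; exists 1; first exact: dhomog1.
  by rewrite rmorph1 mpolyX0.
have -> : (2 * d.+1 = (2 * d).+2)%N by rewrite mulnS.
move=> /mnm_word[v]; rewrite !big_ord_recl addmA => <-.
set i := v _; set j := v _.
have [|F Fd FE] := IH (\sum_(i < 2 * d) U_(v (lift ord0 (lift ord0 i))))%MM.
  by rewrite mdeg_sum (eq_bigr (fun=> 1%N)) ?sum1_card ?card_ord // => l _; rewrite mdeg1.
exists (4^-1 *: prod_var i j * F).
  apply: (@dhomogM _ _ _ 1 _ d) => //; apply/rpredZ/dhomog_prod_var.
rewrite rmorphM /= FE !mpolyXD; congr (_ * _).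
rewrite linearZ /= subst_prod_var -scaler_nat scalerA.
by rewrite mulVf ?scale1r // pnatr_eq0.
Qed.

(** Monomials are lifted one at a time; the last clause lets a lifted matrix keep its zero
    entries. *)
Lemma lift_dhomog d (M : {mpoly R[n]}) : M \is (2 * d).-homog ->
  exists F : {mpoly R[K]},
    [/\ F \is d.-homog, subst_squares F = M & M = 0 -> F = 0].
Proof.
have [->|M0] := eqVneq M 0.
  by exists 0; split=> //; [exact: rpred0|rewrite rmorph0].
move=> /dhomogP Md.
suff [F Fd FM] : exists2 F : {mpoly R[K]}, F \is d.-homog & subst_squares F = M.
  by exists F; split=> // Meq; rewrite Meq eqxx in M0.
rewrite (mpolyE M).
elim: (msupp M) Md => [|g s IH] Md.
  by rewrite big_nil; exists 0; [exact: rpred0|rewrite rmorph0].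
have [|F1 F1d F1E] := IH; first by move=> h hs; apply: Md; rewrite inE hs orbT.
have [|F2 F2d F2E] := @lift_monomial d g; first by apply: Md; rewrite inE eqxx.
exists (M@_g *: F2 + F1); first by apply: rpredD => //; apply: rpredZ.
by rewrite big_cons rmorphD /= F1E linearZ /= F2E.
Qed.
End Lifting.

(** * Certificates for positive definite matrices of forms *)

Section Polyfun.
Variables (R : realType) (N : nat).

Lemma polyfun_ext (f g : 'rV[R]_N -> R) : f =1 g -> polyfun f -> polyfun g.
Proof. by move=> /boolp.funext ->. Qed.

Lemma polyfun_sum (J : Type) (r : seq J) (F : J -> 'rV[R]_N -> R) :
  (forall j, polyfun (F j)) -> polyfun (fun v => \sum_(j <- r) F j v).
Proof.
move=> FP; elim: r => [|j r IH].
  by apply: (polyfun_ext _ (@polyfun_const R N 0)) => v; rewrite big_nil.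
by apply: (polyfun_ext _ (polyfun_add (FP j) IH)) => v; rewrite big_cons.
Qed.

Lemma polyfun_prod (J : Type) (r : seq J) (F : J -> 'rV[R]_N -> R) :
  (forall j, polyfun (F j)) -> polyfun (fun v => \prod_(j <- r) F j v).
Proof.
move=> FP; elim: r => [|j r IH].
  by apply: (polyfun_ext _ (@polyfun_const R N 1)) => v; rewrite big_nil.
by apply: (polyfun_ext _ (polyfun_mul (FP j) IH)) => v; rewrite big_cons.
Qed.

Lemma polyfun_exp (f : 'rV[R]_N -> R) e : polyfun f -> polyfun (fun v => f v ^+ e).
Proof.
move=> fP; elim: e => [|e IH]; first exact: (@polyfun_const R N 1).
by apply: (polyfun_ext _ (polyfun_mul fP IH)) => v; rewrite exprS.
Qed.

Lemma polyfun_meval k (p : {mpoly R[k]}) (i : 'I_k -> 'I_N) :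
  polyfun (fun v => p.@[fun l => v ord0 (i l)]).
Proof.
apply: (@polyfun_ext (fun v => \sum_(g <- msupp p) p@_g * \prod_l (v ord0 (i l)) ^+ g l)).
  by move=> v; rewrite mevalE.
apply: polyfun_sum => g; apply: polyfun_mul; first exact: polyfun_const.
by apply: polyfun_prod => l; apply: polyfun_exp; apply: polyfun_coord.
Qed.
End Polyfun.

(** The penalty argument is run on pairs [(t, z)] with [t] in the simplex and [z] on the unit
    sphere; scaling [z] extends the bound to all vectors. *)
Lemma simplex_lower_bound (R : realType) k (I : finType)
    (F : I -> I -> {mpoly R[k]}) (P : {mpoly R[k]}) :
  (forall t : 'I_k -> R, 0 <= P.@[t]) ->
  (forall (t : 'I_k -> R) (z : I -> R), (forall l, 0 <= t l) -> \sum_l t l = 1 ->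
     P.@[t] = 0 -> (exists a, z a != 0) ->
     0 < quadform (fun a b => (F a b).@[t]) z) ->
  exists lam, exists2 dl, 0 < dl &
    forall (t : 'I_k -> R) (z : I -> R), (forall l, 0 <= t l) -> \sum_l t l = 1 ->
      dl * (\sum_a z a ^+ 2) <=
      quadform (fun a b => (F a b).@[t]) z + lam * P.@[t] * (\sum_a z a ^+ 2).
Proof.
move=> P0 Fpos.
pose N := (k + #|I|)%N.
pose ti (l : 'I_k) : 'I_N := lshift #|I| l.
pose zi (a : I) : 'I_N := rshift k (enum_rank a).
pose tv (v : 'rV[R]_N) l := v ord0 (ti l).
pose zv (v : 'rV[R]_N) a := v ord0 (zi a).
pose f v := quadform (fun a b => (F a b).@[tv v]) (zv v).
pose g v := P.@[tv v].
(* The equations [sum t = 1] and [|z|^2 = 1] become a single inequality: a sum of squares is at most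
   0. *)
pose c (o : option 'I_k) (v : 'rV[R]_N) : R :=
  if o is Some l then - 1 * tv v l
  else (\sum_l tv v l + - 1) ^+ 2 + (\sum_a zv v a ^+ 2 + - 1) ^+ 2.
have cP o : polyfun (c o).
  case: o => [l|] /=; first exact/polyfun_mul/polyfun_coord/polyfun_const.
  apply: polyfun_add; apply: polyfun_exp; apply: polyfun_add;
    try exact: polyfun_const.
    by apply: polyfun_sum => l; apply: polyfun_coord.
  by apply: polyfun_sum => l; apply: polyfun_exp; apply: polyfun_coord.
have fP : polyfun f.
  do 2 (apply: polyfun_sum => ?).
  by do 2 (apply: polyfun_mul; last exact: polyfun_coord); exact: polyfun_meval.
have gP : polyfun g by exact: polyfun_meval.
have cK v : (forall o, c o v <= 0) ->
    [/\ forall l, 0 <= tv v l, \sum_l tv v l = 1 & \sum_a zv v a ^+ 2 = 1].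
  move=> cv; split.
  - by move=> l; have := cv (Some l); rewrite /c /=; lra.
  - have := cv None; rewrite /c.
    set s := \sum_l _; set s' := \sum_a _ => h.
    have h' := sqr_ge0 (s' + - 1).
    have : (s + - 1) ^+ 2 = 0 by apply: le_anti; rewrite sqr_ge0 andbT; lra.
    by move=> /eqP; rewrite sqrf_eq0 subr_eq0 => /eqP.
  - have := cv None; rewrite /c.
    set s := \sum_l _; set s' := \sum_a _ => h.
    have h' := sqr_ge0 (s + - 1).
    have : (s' + - 1) ^+ 2 = 0 by apply: le_anti; rewrite sqr_ge0 andbT; lra.
    by move=> /eqP; rewrite sqrf_eq0 subr_eq0 => /eqP.
have [| |lam [dl dl0 hdl]] := @penalty_lower_bound R N _ c f g 1 cP fP gP.
- by move=> v; exact: P0.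
- move=> v _ /cK[t0 t1 z1] gv; apply: Fpos => //.
  apply/existsP; apply: contra_eqT z1; rewrite negb_exists => /forallP z0.
  suff -> : \sum_a zv v a ^+ 2 = 0 by rewrite eq_sym oner_eq0.
  apply: big1 => a _; apply/eqP.
  by rewrite sqrf_eq0; have := z0 a; rewrite negbK.
exists lam, dl => // t z t0 t1.
set s := \sum_a _.
have s0 : 0 <= s by apply: sumr_ge0 => a _; rewrite sqr_ge0.
have [sz|snz] := eqVneq s 0.
  rewrite sz !mulr0 addr0 [quadform _ _]big1 // => a _; rewrite big1 // => b _.
  suff -> : z a = 0 by rewrite mulr0 mul0r.
  move/eqP: sz; rewrite psumr_eq0 => [|? _]; last by rewrite sqr_ge0.
  by move/allP => /(_ a (mem_index_enum _)); rewrite /= sqrf_eq0 => /eqP.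
have sp : 0 < s by rewrite lt_def snz.
pose r := Num.sqrt s.
have r0 : 0 < r by rewrite sqrtr_gt0.
have r2 : r ^+ 2 = s by rewrite sqr_sqrtr.
pose v : 'rV[R]_N := row_mx (\row_l t l) (\row_a (z (enum_val a) / r)).
have tvE : tv v = t by apply: boolp.funext => l; rewrite /tv row_mxEl mxE.
have zvE a : zv v a = z a / r by rewrite /zv row_mxEr mxE enum_rankK.
have z1 : \sum_a zv v a ^+ 2 = 1.
  under eq_bigr do rewrite zvE expr_div_n r2.
  by rewrite -mulr_suml divff.
have zle a : zv v a ^+ 2 <= 1.
  by rewrite -z1 (bigD1 a) //= lerDl sumr_ge0 // => ? _; rewrite sqr_ge0.
have tle l : t l <= 1.
  by rewrite -t1 (bigD1 l) //= lerDl sumr_ge0.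
have := hdl v.
have fE : f v = quadform (fun a b => (F a b).@[t]) z / s.
  rewrite /f tvE /quadform mulr_suml; apply: eq_bigr => a _.
  rewrite mulr_suml; apply: eq_bigr => b _; rewrite !zvE -r2.
  by field; rewrite gt_eqF.
rewrite fE /g tvE => H.
have {H} : dl <= quadform (fun a b => (F a b).@[t]) z / s + lam * P.@[t].
  apply: H.
    move=> i; rewrite -(splitK i); case: (split i) => [l|a] /=.
      by rewrite -/(tv v l) tvE ger0_norm.
    have := zle (enum_val a); rewrite /zv /zi enum_valK => h.
    by rewrite -(@ler_pXn2r _ 2) ?nnegrE // expr1n real_normK ?num_real.
  move=> [l|] /=; first by rewrite tvE mulN1r oppr_le0.
  by rewrite tvE t1 z1 subrr expr0n /= addr0.
move=> h; have := ler_wpM2r s0 h.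
by rewrite mulrDl divfK.
Qed.

(** [M] is lifted, penalised, expanded by Polya's theorem and substituted back. Zeros are preserved
    off the diagonal, where the penalty adds nothing. *)
Lemma matrix_form_certificate (R : realType) (n d : nat) (I : finType)
    (M : I -> I -> {mpoly R[n]}) :
  (0 < n)%N ->
  (forall a b, M a b \is (2 * d).-homog) ->
  (forall a b, M a b = M b a) ->
  (forall (x : 'I_n -> R) (z : I -> R), (exists i, x i != 0) ->
     (exists a, z a != 0) -> 0 < quadform (fun a b => (M a b).@[x]) z) ->
  exists nu (J : finType) (q : J -> {mpoly R[n]}) (A : J -> I -> I -> R),
    [/\ forall j, psd (A j),
        forall j a b, a != b -> M a b = 0 -> A j a b = 0 &
        forall a b, (\sum_i 'X_i ^+ 2) ^+ nu * M a b = \sum_j A j a b *: q j ^+ 2].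
Proof.
move=> n0 Md Msym Mpos.
pose theta := comp_mpoly (pm_squares R n).
(* With the homogeneity condition inside the existential, choice yields a total function; the lift
   depends only on the polynomial, so the lifted matrix is symmetric. *)
have liftP (p : {mpoly R[n]}) : exists F, p \is (2 * d).-homog ->
    [/\ F \is d.-homog, theta F = p & p = 0 -> F = 0].
  by case: (boolP (p \is (2 * d).-homog)) => [/lift_dhomog[F FP]|_]; [exists F|exists 0].
have [lft lftP] := boolp.choice liftP.
pose F a b := lft (M a b).
have Fd a b : F a b \is d.-homog by case: (lftP _ (Md a b)).
have FE a b : theta (F a b) = M a b by case: (lftP _ (Md a b)).
pose P := penalty R n; pose S := var_sum R n.
have [|lam [dl dl0 hdl]] := @simplex_lower_bound R _ I F P (@meval_penalty_ge0 R n).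
  move=> t z t0 t1 Pt znz; have [x xnz xt] := penalty_eq0 t0 t1 Pt.
  have := Mpos x z xnz znz; congr (_ < _); apply: eq_quadform => a b.
  rewrite -FE /theta comp_mpoly_meval; apply: meval_eq => l.
  by rewrite tnth_mktuple xt.
(* The powers of [S] bring both terms to degree [d + 4] and equal 1 on the simplex; the penalty term
   vanishes after substitution. *)
pose G a b := F a b * S ^+ 4 + (lam *+ (a == b)) *: (P * S ^+ d).
have SE t : \sum_l t l = 1 -> S.@[t] = 1.
  by move=> <-; rewrite rmorph_sum /=; apply: eq_bigr => l _; rewrite mevalXU.
have [||t z t0 t1|m [N [A [Apsd A0 AE]]]] := @matrix_polya R _ (d + 4) I G dl dl0.
- move=> a b; apply: rpredD.
    by apply: dhomogM => //; apply: (dhomogMn 4 (dhomog_var_sum R n)).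
  rewrite addnC; apply: rpredZ; apply: dhomogM; first exact: dhomog_penalty.
  by have := dhomogMn d (dhomog_var_sum R n); rewrite mul1n.
- by move=> a b; rewrite /G /F Msym eq_sym.
- apply: le_trans (hdl t z t0 t1) _.
  rewrite [X in _ <= X](_ : _ = quadform (fun a b => (F a b).@[t]) z +
     quadform (fun a b => lam * P.@[t] * (a == b)%:R) z); last first.
    rewrite /quadform -big_split; apply: eq_bigr => a _.
    rewrite -big_split; apply: eq_bigr => b _ /=.
    rewrite -!mulrDl; congr (_ * _ * _).
    rewrite /G mevalD mevalM rmorphXn mevalZ mevalM rmorphXn /= SE // !expr1n !mulr1.
    by rewrite mulrnAl mulr_natr.
  rewrite lerD2l quadformZ le_eqVlt; apply/orP; left; apply/eqP; congr (_ * _).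
  apply: eq_bigr => a _; rewrite (bigD1 a) //= eqxx mul1r big1 ?addr0 ?expr2 // => b.
  by rewrite eq_sym => /negPf ->; rewrite !mul0r.
have n40 : ((4 * n) ^ (m + 4))%:R != 0 :> R.
  by rewrite pnatr_eq0 -lt0n expn_gt0 muln_gt0 n0.
pose W : finType := {ffun 'I_N -> 'I_#|{: 'I_n * 'I_n * bool}|}.
(* Substitution turns [S ^+ m * G] into [M] times the power [m + 4] of [4n |x|^2], and each word
   into a square; the constant is moved into the matrices. *)
exists (m + 4)%N, W.
exists (fun w : W => \prod_j pm_form R (enum_val (w j))).
exists (fun (w : W) a b => ((4 * n) ^ (m + 4))%:R^-1 * A w a b); split.
- move=> w; have [As Ap] := Apsd w; split=> [a b|z]; first by rewrite As.
  by rewrite quadformZ mulr_ge0 // invr_ge0.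
- move=> w a b ab Mab; rewrite A0 ?mulr0 // /G (negPf ab) mulr0n scale0r addr0.
  have [_ _ F0] := lftP _ (Md a b).
  by rewrite [F a b]F0 ?mul0r.
move=> a b.
have thS : theta S = (\sum_i 'X_i ^+ 2) *+ (4 * n) by exact: subst_var_sum.
have thG : theta (G a b) = M a b * theta S ^+ 4.
  rewrite /theta rmorphD rmorphM rmorphXn /= linearZ /= rmorphM /=.
  by rewrite [P \mPo _]subst_penalty mul0r scaler0 addr0 [F a b \mPo _]FE.
have := congr1 theta (AE a b).
rewrite {1}/theta rmorphM rmorphXn /= -/theta thG thS.
rewrite mulrCA -exprD mulrC.
rewrite -[_ *+ (4 * n)]mulr_natl exprMn -natrX.
rewrite -mulrA mulr_natl -scaler_nat => E.
apply: (scalerI n40); rewrite E.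
rewrite /theta rmorph_sum scaler_sumr; apply: eq_bigr => w _ /=.
rewrite linearZ /= !scalerA mulrA divff // mul1r; congr (_ *: _).
rewrite rmorph_prod -prodrXl; apply: eq_bigr => j _ /=.
by rewrite comp_mpolyXU -tnth_nth tnth_mktuple.
Qed.

(** * The Gram matrix in y and the clique decomposition *)

Section Gram.
Variables (R : realType) (n m : nat).

Definition xvars : n.-tuple {mpoly R[n + m]} := [tuple 'X_(lshift m i) | i < n].

(** The vector [z = (c, y)], with [c = 0] when [p] is a quadratic form in [y] and [c = 1]
    otherwise. *)
Definition yvec (c : R) (a : option 'I_m) : {mpoly R[n + m]} :=
  if a is Some j then 'X_(rshift n j) else c%:MP.

Definition ymnm (a : option 'I_m) : 'X_{1..m} :=
  if a is Some j then U_(j)%MM else 0%MM.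

Definition ymon (b : 'X_{1..m}) : {mpoly R[n + m]} :=
  \prod_j 'X_(rshift n j) ^+ b j.

Lemma mpolyX_split (g : 'X_{1..(n + m)}) :
  'X_[g] = ('X_[xpart g] \mPo xvars) * ymon (ypart g) :> {mpoly R[n + m]}.
Proof.
rewrite mpolyXE_id big_split_ord /= comp_mpolyX; congr (_ * _).
  by apply: eq_bigr => i _; rewrite tnth_mktuple mnmE.
by apply: eq_bigr => i _; rewrite mnmE.
Qed.

Lemma ymonD b b' : ymon (b + b')%MM = ymon b * ymon b'.
Proof.
by rewrite /ymon -big_split; apply: eq_bigr => j _; rewrite mnmDE exprD.
Qed.

Lemma mdeg_ymnm a : (mdeg (ymnm a) <= 1)%N.
Proof. by case: a => [j|] /=; rewrite ?mdeg1 ?mdeg0. Qed.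

Lemma yvec_ymon c a : yvec c a = c ^+ (1 - mdeg (ymnm a)) *: ymon (ymnm a).
Proof.
case: a => [j|] /=.
  rewrite mdeg1 subnn expr0 scale1r /ymon (bigD1 j) //= mnm1E eqxx expr1.
  by rewrite big1 ?mulr1 // => i; rewrite mnm1E eq_sym => /negPf ->.
rewrite mdeg0 subn0 expr1 /ymon big1 ?alg_mpolyC // => i _.
by rewrite mnm0E.
Qed.

Definition ypairs (b : 'X_{1..m}) : {set option 'I_m * option 'I_m} :=
  [set c | b == (ymnm c.1 + ymnm c.2)%MM].

Lemma ypairs_neq0 b : (mdeg b <= 2)%N -> ypairs b != set0.
Proof.
move=> b2; apply/set0Pn.
have [b0|b0] := eqVneq (mdeg b) 0%N.
  exists (None, None); rewrite inE /=; apply/eqP.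
  by apply/eqP; rewrite addm0 -mdeg_eq0 b0.
have [b1|b1] := eqVneq (mdeg b) 1%N.
  have /eqP/mdeg1P[j /eqP ->] := b1.
  by exists (Some j, None); rewrite inE /= addm0.
have b2' : mdeg b = 2%N by move: b0 b1 b2; case: (mdeg b) => [|[|[|]]].
have [v <-] := mnm_word b2'.
by exists (Some (v ord0), Some (v (lift ord0 ord0))); rewrite inE /= !big_ord_recl big_ord0 addm0.
Qed.

(* [y^b] is split equally between the entries [(u, v)] with [z_u z_v = y^b]. *)
Definition gram_coeff (b : 'X_{1..m}) (u v : option 'I_m) : R :=
  ((u, v) \in ypairs b)%:R / #|ypairs b|%:R.

(** A pair [(u, v)] spelling [y^b] contains the constant coordinate [2 - |b|] times, and the equal
    shares add up to 1. *)
Lemma gram_coeff_sum c b : (mdeg b <= 2)%N ->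
  \sum_u \sum_v gram_coeff b u v *: (yvec c u * yvec c v) =
  c ^+ (2 - mdeg b) *: ymon b.
Proof.
move=> b2; rewrite pair_bigA /=.
transitivity (\sum_(p in ypairs b) (#|ypairs b|%:R^-1 : R) *: (c ^+ (2 - mdeg b) *: ymon b)).
  rewrite [RHS]big_mkcond; apply: eq_bigr => -[u v] _ /=.
  rewrite /gram_coeff; case: ifP => [|_]; last by rewrite mul0r scale0r.
  rewrite inE mul1r => /eqP /= ->; congr (_ *: _).
  rewrite !yvec_ymon -scalerAl -scalerAr scalerA -exprD ymonD mdegD; congr (_ ^+ _ *: _).
  by case: (mdeg _) (mdeg_ymnm u) => [|[|]] // _; case: (mdeg _) (mdeg_ymnm v) => [|[|]].
rewrite sumr_const -scaler_nat scalerA divff ?scale1r //.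
by rewrite pnatr_eq0 cards_eq0 ypairs_neq0.
Qed.

Variable p : {mpoly R[n + m]}.

Definition gram (u v : option 'I_m) : {mpoly R[n]} :=
  \sum_(g <- msupp p) (p@_g * gram_coeff (ypart g) u v) *: 'X_[xpart g].

(** [c] is the value of the homogenizing variable: 1 gives back [p], and 0 leaves the part of degree
    2 in [y], by [0 ^+ 0 = 1]. *)
Definition yhomogenized (c : R) : {mpoly R[n + m]} :=
  \sum_(g <- msupp p) (c ^+ (2 - mdeg (ypart g)) * p@_g) *: 'X_[g].

Lemma gram_sum c : yquadratic p ->
  \sum_u \sum_v (gram u v \mPo xvars) * (yvec c u * yvec c v) = yhomogenized c.
Proof.
move=> p2; rewrite /yhomogenized.
transitivity (\sum_u \sum_v \sum_(g <- msupp p)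
  (p@_g * gram_coeff (ypart g) u v) *: ('X_[xpart g] \mPo xvars) * (yvec c u * yvec c v)).
  apply: eq_bigr => u _; apply: eq_bigr => v _.
  by rewrite rmorph_sum mulr_suml; apply: eq_bigr => g _ /=; rewrite linearZ.
under eq_bigr do rewrite exchange_big.
rewrite exchange_big /= big_seq [RHS]big_seq; apply: eq_bigr => g /p2 g2.
rewrite mpolyX_split mulrC -scalerA scalerAr -gram_coeff_sum //.
rewrite mulr_sumr scaler_sumr; apply: eq_bigr => u _.
rewrite mulr_sumr scaler_sumr; apply: eq_bigr => v _.
by rewrite -scalerAr scalerA -scalerAl.
Qed.

Lemma yhomogenized1 : yhomogenized 1 = p.
Proof.
by rewrite [RHS]mpolyE; apply: eq_bigr => g _; rewrite expr1n mul1r.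
Qed.

Lemma yhomogenized0 d : xhomog (2 * d) p -> yquadratic p ->
  yhomogenized 0 = bihomog_part (2 * d) 2 p.
Proof.
move=> px p2; rewrite /bihomog_part [RHS]big_mkcond [LHS]big_seq [RHS]big_seq.
apply: eq_bigr => g gp; rewrite (px g gp) eqxx /=.
have := p2 g gp; case: (mdeg _) => [|[|[|]]] // _ /=.
- by rewrite expr0n mul0r scale0r.
- by rewrite expr0n mul0r scale0r.
- by rewrite expr0 mul1r.
Qed.

Lemma yhomogenized_yhomog c : yhomog 2 p -> yhomogenized c = p.
Proof.
move=> p2; rewrite [RHS]mpolyE [LHS]big_seq [RHS]big_seq; apply: eq_bigr => g gp.
by rewrite p2 // subnn expr0 mul1r.
Qed.

Lemma gram_eval c (x : 'rV[R]_n) (y : 'rV[R]_m) : yquadratic p ->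
  quadform (fun u v => (gram u v).@[x ord0])
    (fun u => if u is Some j then y ord0 j else c) =
  eval_xy (yhomogenized c) x y.
Proof.
move=> p2; rewrite -gram_sum // /eval_xy rmorph_sum; apply: eq_bigr => u _ /=.
rewrite rmorph_sum; apply: eq_bigr => v _ /=.
rewrite !rmorphM /= mulrA; congr (_ * _ * _).
- rewrite comp_mpoly_meval; apply: meval_eq => i.
  by rewrite tnth_mktuple mevalXU row_mxEl.
- by case: u => [j|] /=; rewrite ?mevalXU ?row_mxEr ?mevalC.
- by case: v => [j|] /=; rewrite ?mevalXU ?row_mxEr ?mevalC.
Qed.

Lemma gram_sym u v : gram u v = gram v u.
Proof.
by apply: eq_bigr => g _; rewrite /gram_coeff !inE /= addmC.
Qed.

Lemma dhomog_gram k u v : xhomog k p -> gram u v \is k.-homog.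
Proof.
move=> px; rewrite /gram big_seq; apply: rpred_sum => g gp; apply: rpredZ.
by rewrite dhomogX; apply/eqP; exact: px.
Qed.

(** This entry only collects terms of [p] whose part in [y] is [y_i y_j], and such a term puts the
    edge into the graph. *)
Lemma gram_sparse i j : i != j -> gram (Some i) (Some j) != 0 -> csp_graph p i j.
Proof.
move=> ij; apply: contraR; rewrite /csp_graph ij mxE (negPf ij) /= eqb1.
move=> /hasPn nog; rewrite /gram big_seq big1 // => g gp.
rewrite /gram_coeff inE /=; case: eqP => [gE|_]; last by rewrite mul0r mulr0 scale0r.
have := nog g gp; rewrite gE !mnmDE !mnm1E !eqxx.
by rewrite [j == i]eq_sym (negPf ij).
Qed.

Lemma csp_graph_sym i j : csp_graph p i j = csp_graph p j i.
Proof.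
rewrite /csp_graph eq_sym !mxE eq_sym; congr (_ && (nat_of_bool (_ || _) == _)).
by apply: eq_has => g; rewrite mulnC.
Qed.

Lemma csp_graph_irr : irreflexive (csp_graph p).
Proof. by move=> i; rewrite /csp_graph eqxx. Qed.
End Gram.

(** * Assembling the sums of squares on the cliques *)

Lemma comp_mpolyA (R : comNzRingType) (n k l : nat) (p : {mpoly R[n]})
    (s : n.-tuple {mpoly R[k]}) (s' : k.-tuple {mpoly R[l]}) :
  (p \mPo s) \mPo s' = p \mPo [tuple tnth s i \mPo s' | i < n].
Proof.
rewrite [p \mPo s]comp_mpolyE [RHS]comp_mpolyE rmorph_sum /=.
apply: eq_bigr => g _; rewrite linearZ rmorph_prod; congr (_ *: _).
by apply: eq_bigr => i _; rewrite rmorphXn tnth_mktuple.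
Qed.

Lemma sum_option (V : nmodType) (T : finType) (F : option T -> V) :
  \sum_u F u = F None + \sum_i F (Some i).
Proof.
rewrite (bigD1 None) //=; congr (_ + _).
rewrite (reindex_omap Some id) /=; last by case.
by apply: eq_bigl => i; rewrite eqxx.
Qed.

Section YDegree.
Variables (R : realType) (n m : nat).
Implicit Types p q : {mpoly R[n + m]}.

(** [yquadratic] with a variable bound, so that degrees add under products; at [e = 2] the two are
    convertible. *)
Definition ydeg_le (e : nat) p : Prop :=
  forall g, g \in msupp p -> (mdeg (ypart g) <= e)%N.

Lemma ydeg_le_sum e (J : Type) (r : seq J) (F : J -> {mpoly R[n + m]}) :
  (forall j, ydeg_le e (F j)) -> ydeg_le e (\sum_(j <- r) F j).
Proof.
move=> Fe; elim: r => [|j r IH] g; first by rewrite big_nil msupp0.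
by rewrite big_cons => /msuppD_le; rewrite mem_cat => /orP[/Fe|/IH].
Qed.

Lemma ypartD (g h : 'X_{1..(n + m)}) : ypart (g + h)%MM = (ypart g + ypart h)%MM.
Proof. by apply/mnmP => j; rewrite !(mnmE, mnmDE). Qed.

Lemma ydeg_leM e f p q : ydeg_le e p -> ydeg_le f q -> ydeg_le (e + f) (p * q).
Proof.
move=> pe qf g /msuppM_le /allpairsP[[g1 g2] /= [/pe h1 /qf h2 ->]].
by rewrite ypartD mdegD leq_add.
Qed.

Lemma ydeg_le_xvars (f : {mpoly R[n]}) : ydeg_le 0 (f \mPo xvars R n m).
Proof.
rewrite comp_mpolyEX; apply: ydeg_le_sum => g h /msuppZ_le.
rewrite comp_mpolyX (eq_bigr (fun i => 'X_[U_(lshift m i)] ^+ g i)); last first.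
  by move=> i _; rewrite tnth_mktuple.
rewrite mprodXnE msuppX inE => /eqP ->.
rewrite leqn0 mdeg_eq0; apply/eqP/mnmP => j; rewrite mnmE mnm_sumE mnm0E big1 // => i _.
by rewrite mulmnE mnm1E eq_lrshift.
Qed.

Lemma ydeg_le_yvec c u : ydeg_le 1 (@yvec R n m c u).
Proof.
case: u => [j|] g /=.
  rewrite msuppX inE => /eqP ->.
  rewrite mdegE (bigD1 j) //= big1 => [|i /negPf ij].
    by rewrite mnmE mnm1E addn0 leq_b1.
  by rewrite mnmE mnm1E eq_rshift eq_sym ij.
rewrite msuppC; case: ifP => // _; rewrite inE => /eqP ->.
by rewrite mdegE big1 // => i _; rewrite mnmE mnm0E.
Qed.
End YDegree.

Section Assembly.
Variables (R : realType) (n m t : nat) (C : 'I_t -> {set 'I_m}) (c : R).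
Local Notation term := ({mpoly R[n]} * {ffun option 'I_m -> R})%type.
Variable L : seq term.
Variable kap : {ffun option 'I_m -> R} -> 'I_t.
Hypothesis kapP : forall e : term, e \in L -> [set i | e.2 (Some i) != 0] \subset C (kap e.2).

(** For a term [(q, f)] this is [q] times the linear form in [(c, y)] with coefficients [f],
    restricted to the variables of clique [k]; nothing is lost when the support of [f] lies in that
    clique. *)
Definition clique_linear_form k (e : term) :
    {mpoly R[n + #|C k|]} :=
  \sum_u ((e.2 (omap enum_val u) *: e.1) \mPo xvars R n #|C k|) * yvec n c u.

(** [kap] assigns one clique to each vector, so a term whose support lies in several cliques is
    counted once. *)
Definition clique_sos k : {mpoly R[n + #|C k|]} :=
  \sum_(e <- [seq e : term <- L | kap e.2 == k]) clique_linear_form k e ^+ 2.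

Lemma is_sos_clique_sos k : is_sos (clique_sos k).
Proof.
by exists [seq clique_linear_form k e | e <- L & kap e.2 == k]; rewrite big_map.
Qed.

Lemma yquadratic_clique_sos k : yquadratic (clique_sos k).
Proof.
apply: ydeg_le_sum => e; rewrite expr2; apply: (@ydeg_leM _ _ _ 1 1);
  by apply: ydeg_le_sum => u; apply: (@ydeg_leM _ _ _ 0 1);
    [exact: ydeg_le_xvars|exact: ydeg_le_yvec].
Qed.

Lemma subst_y_clique_linear_form k (e : term) : [set i | e.2 (Some i) != 0] \subset C k ->
  subst_y (clique_linear_form k e) =
  \sum_u ((e.2 u *: e.1) \mPo xvars R n m) * yvec n c u.
Proof.
move=> /subsetP eC; rewrite /subst_y rmorph_sum /= !sum_option /=.
have xE f : (f \mPo xvars R n #|C k|) \mPo [tuple match split i with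
                | inl k => 'X_(lshift m k)
                | inr j => 'X_(rshift n (enum_val j))
                end | i < n + #|C k|] = f \mPo xvars R n m.
  rewrite comp_mpolyA; congr (_ \mPo _); apply: eq_from_tnth => i.
  rewrite !tnth_mktuple comp_mpolyXU -tnth_nth tnth_mktuple.
  by rewrite -/(unsplit (inl i)) unsplitK.
rewrite rmorphM /= xE comp_mpolyC; congr (_ + _).
rewrite [RHS](bigID (mem (C k))) /= [X in _ = _ + X]big1 => [|i iC]; last first.
  have [->|nz] := eqVneq (e.2 (Some i)) 0; first by rewrite scale0r linear0 mul0r.
  by rewrite eC ?inE in iC.
rewrite addr0 [RHS]big_enum_val; apply: eq_bigr => j _.
rewrite rmorphM /= xE comp_mpolyXU -tnth_nth tnth_mktuple.
by rewrite -/(unsplit (inr j)) unsplitK.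
Qed.

Lemma sum_clique_sos :
  \sum_k subst_y (clique_sos k) =
  \sum_u \sum_v ((\sum_(e <- L) (e.2 u * e.2 v) *: e.1 ^+ 2) \mPo xvars R n m) *
     (yvec n c u * yvec n c v).
Proof.
transitivity (\sum_(e <- L) (\sum_u ((e.2 u *: e.1) \mPo xvars R n m) * yvec n c u) ^+ 2).
  transitivity (\sum_k \sum_(e <- L | kap e.2 == k)
      (\sum_u ((e.2 u *: e.1) \mPo xvars R n m) * yvec n c u) ^+ 2).
    apply: eq_bigr => k _; rewrite /clique_sos big_filter /subst_y rmorph_sum.
    rewrite big_seq_cond [RHS]big_seq_cond; apply: eq_bigr => e /andP[eL /eqP ek].
    rewrite rmorphXn /= -/(subst_y _) subst_y_clique_linear_form //.
    by rewrite -ek kapP.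
  rewrite (exchange_big_dep xpredT) //=; apply: eq_bigr => e _.
  by rewrite (big_pred1 (kap e.2)) // => k; rewrite eq_sym.
under [RHS]eq_bigr => u _.
  under eq_bigr => v _ do rewrite rmorph_sum mulr_suml.
  rewrite exchange_big /=.
  over.
rewrite [RHS]exchange_big /=; apply: eq_bigr => e _.
rewrite expr2 mulr_suml; apply: eq_bigr => u _; rewrite mulr_sumr.
apply: eq_bigr => v _; rewrite !linearZ /= rmorphXn /= -!scalerAl -!scalerAr scalerA.
by congr (_ *: _); ring.
Qed.
End Assembly.

Lemma normx2_xvars (R : realType) n m :
  (\sum_(i < n) 'X_i ^+ 2) \mPo xvars R n m = normx2 R n m.
Proof.
rewrite rmorph_sum; apply: eq_bigr => i _.
by rewrite rmorphXn /= comp_mpolyXU -tnth_nth tnth_mktuple.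
Qed.

(** The common part of the two cases of the theorem, for any definite sparse Gram matrix [M] of [p].
    Each [A j] splits into vectors supported on cliques, and [q j] with such a vector gives one
    square. *)
Lemma gram_certificate (R : realType) (n m d t : nat) (p : {mpoly R[n + m]})
    (C : 'I_t -> {set 'I_m}) (c : R) (M : option 'I_m -> option 'I_m -> {mpoly R[n]}) :
  (0 < n)%N ->
  chordal (csp_graph p) ->
  (forall S : {set 'I_m}, clique (csp_graph p) S -> exists k, S \subset C k) ->
  (forall u v, M u v \is (2 * d).-homog) ->
  (forall u v, M u v = M v u) ->
  (forall i j, i != j -> M (Some i) (Some j) != 0 -> csp_graph p i j) ->
  (forall (x : 'I_n -> R) (z : option 'I_m -> R), (exists i, x i != 0) ->
     (exists u, z u != 0) -> 0 < quadform (fun u v => (M u v).@[x]) z) ->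
  \sum_u \sum_v (M u v \mPo xvars R n m) * (yvec n c u * yvec n c v) = p ->
  exists (nu : nat) (sigma : forall k : 'I_t, {mpoly R[n + #|C k|]}),
    (forall k, is_sos (sigma k) /\ yquadratic (sigma k)) /\
    normx2 R n m ^+ nu * p = \sum_(k < t) subst_y (sigma k).
Proof.
move=> n0 chord Ccl Md Msym Msp Mpos Mp.
have [nu [J [q [A [Apsd A0 AE]]]]] := matrix_form_certificate n0 Md Msym Mpos.
have dec j : exists s : seq {ffun option 'I_m -> R},
    (forall a b, A j a b = \sum_(f <- s) f a * f b) /\
    (forall f, f \in s -> clique (csp_graph p) [set i | f (Some i) != 0]).
  apply: (@chordal_psd_decomposition _ _ _ (@csp_graph_sym R n m p)
    (@csp_graph_irr R n m p) chord (A j) [set: 'I_m]) => //.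
    by move=> i b; rewrite inE.
  move=> i i' nz; case: (eqVneq i i') => //= ii'.
  apply: Msp => //; apply: contraNneq nz => M0; rewrite A0 //.
have [s sP] := boolp.choice dec.
pose L := [seq (q j, f) | j <- enum J, f <- s j].
have Lcl (e : {mpoly R[n]} * {ffun option 'I_m -> R}) :
    e \in L -> clique (csp_graph p) [set i | e.2 (Some i) != 0].
  by move=> /allpairsPdep[j [f [_ fs ->]]] /=; apply: (sP j).2.
(* A default index for [kap], obtained from the empty clique; on [L] it is never reached. *)
have [k0 _] : exists k, set0 \subset C k.
  by apply: Ccl; apply/forall_inP => i; rewrite inE.
pose kap (f : {ffun option 'I_m -> R}) : 'I_t :=
  odflt k0 [pick k | [set i | f (Some i) != 0] \subset C k].
have kapP (e : {mpoly R[n]} * {ffun option 'I_m -> R}) :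
    e \in L -> [set i | e.2 (Some i) != 0] \subset C (kap e.2).
  move=> /Lcl /Ccl [k ek]; rewrite /kap; case: pickP => [//|/(_ k)].
  by rewrite ek.
exists nu, (clique_sos C c L kap); split.
  by move=> k; split; [exact: is_sos_clique_sos|exact: yquadratic_clique_sos].
rewrite (sum_clique_sos c kapP) -Mp mulr_sumr; apply: eq_bigr => u _.
rewrite mulr_sumr; apply: eq_bigr => v _; rewrite mulrA; congr (_ * _).
rewrite -normx2_xvars -rmorphXn -rmorphM /= AE; congr (_ \mPo _).
rewrite big_allpairs_dep big_enum /=; apply: eq_bigr => j _.
by rewrite (sP j).1 scaler_suml.
Qed.

Theorem corollary4p2 (R : realType) (n m d t : nat) (p : {mpoly R[n + m]})
    (C : 'I_t -> {set 'I_m})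
    (m_gt0 : (0 < m)%N)
    (p_xhomog : xhomog (2 * d) p)
    (p_yquadratic : yquadratic p)
    (G_chordal : chordal (csp_graph p))
    (C_inj : injective C)
    (C_cliques : forall S : {set 'I_m},
        maximal_clique (csp_graph p) S <-> exists k, S = C k)
    (top_pos : forall (x : 'rV[R]_n) (y : 'rV[R]_m), x != 0 -> y != 0 ->
        0 < eval_xy (bihomog_part (2 * d) 2 p) x y)
    (p_pos : ~ (exists k : nat, yhomog k p) ->
        forall (x : 'rV[R]_n) (y : 'rV[R]_m), x != 0 -> 0 < eval_xy p x y) :
  exists (nu : nat) (sigma : forall k : 'I_t, {mpoly R[n + #|C k|]}),
    (forall k, is_sos (sigma k) /\ yquadratic (sigma k)) /\
    normx2 R n m ^+ nu * p = \sum_(k < t) subst_y (sigma k).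
Proof.
(* For [n = 0] the polynomial [|x|^2] is zero, so [nu = 1] makes both sides vanish. *)
have [n0|n_gt0] := posnP n.
  exists 1%N, (fun=> 0); split.
    move=> k; split; first by exists [::]; rewrite big_nil.
    by move=> g; rewrite msupp0.
  rewrite big1 => [|k _]; last by rewrite /subst_y rmorph0.
  rewrite expr1 /normx2 big1 ?mul0r // => i _.
  by have := ltn_ord i; rewrite [X in (_ < X)%N]n0.
have Ccl (S : {set 'I_m}) : clique (csp_graph p) S -> exists k, S \subset C k.
  move=> /maxset_exists[S' /C_cliques[k ->] SC]; by exists k.
have x_neq0 (x : 'I_n -> R) : (exists i, x i != 0) -> \row_i x i != 0 :> 'rV[R]_n.
  by move=> [i xi]; apply: contraNneq xi => /rowP /(_ i); rewrite !mxE => ->.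
have evalx (x : 'I_n -> R) (f : {mpoly R[n]}) : f.@[x] = f.@[(\row_i x i : 'rV[R]_n) ord0].
  by apply: meval_eq => i; rewrite mxE.
have gram_evalx (x : 'I_n -> R) z :
    quadform (fun u v => (gram p u v).@[x]) z =
    eval_xy (yhomogenized p (z None)) (\row_i x i) (\row_j z (Some j)).
  rewrite -gram_eval //; apply: eq_bigr => u _; apply: eq_bigr => v _.
  by rewrite -evalx; congr (_ * _ * _); [case: u|case: v] => //= j; rewrite mxE.
(* With constant coordinate 0 only the part of degree 2 in [y] is seen. *)
have top_gram (x : 'I_n -> R) z : (exists i, x i != 0) ->
    (exists j, z (Some j) != 0) -> z None = 0 ->
    0 < quadform (fun u v => (gram p u v).@[x]) z.
  move=> xnz [j zj] z0; rewrite gram_evalx z0 (yhomogenized0 p_xhomog) //.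
  apply: top_pos; first exact: x_neq0.
  by apply: contraNneq zj => /rowP /(_ j); rewrite !mxE => ->.
have [/allP p2|np2] := boolP (all (fun g => mdeg (ypart g) == 2) (msupp p)).
  have p_yhomog : yhomog 2 p by move=> g /p2 /eqP.
  (* The constant coordinate is switched off ([c = 0]); the corner entry
     [|x|^(2d)] only serves to make the matrix definite. *)
  pose M u v : {mpoly R[n]} := gram p u v +
    (if (u == None) && (v == None) then (\sum_i 'X_i ^+ 2) ^+ d else 0).
  apply: (@gram_certificate R n m d t p C 0 M) => //.
  - move=> u v; apply: rpredD; first exact: dhomog_gram.
    case: ifP => _; last exact: rpred0.
    apply: dhomogMn; apply: rpred_sum => i _.
    by apply: (@dhomogMn _ _ _ 1 _ 2); rewrite dhomogX; apply/eqP; exact: mdeg1.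
  - by move=> u v; rewrite /M gram_sym andbC.
  - by move=> i j ij; rewrite /M addr0; exact: gram_sparse.
  - move=> x z xnz [u zu].
    pose z' u := if u is Some j then z (Some j) else 0.
    have -> : quadform (fun u v => (M u v).@[x]) z =
        quadform (fun u v => (gram p u v).@[x]) z' + (\sum_i x i ^+ 2) ^+ d * z None ^+ 2.
      (* For a quadratic form in [y] the constant coordinate does not enter the Gram form. *)
      have -> : quadform (fun u v => (gram p u v).@[x]) z' =
                quadform (fun u v => (gram p u v).@[x]) z.
        by rewrite !gram_evalx !yhomogenized_yhomog.
      apply/eqP; rewrite addrC -subr_eq; apply/eqP.
      rewrite /quadform -sumrB sum_option [X in _ + X]big1 ?addr0.
        rewrite -sumrB sum_option [X in _ + X]big1 ?addr0.
          rewrite -!mulrBl mevalD addrC addKr /= rmorphXn rmorph_sum /= -mulrA -expr2.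
          by congr (_ ^+ _ * _); apply: eq_bigr => i _; rewrite rmorphXn /= mevalXU.
        by move=> j _; rewrite /M /= addr0 subrr.
      by move=> j _; rewrite -sumrB big1 // => v _; rewrite /M /= addr0 subrr.
    have x2 : 0 < \sum_i x i ^+ 2.
      have [i xi] := xnz; rewrite (bigD1 i) //= ltr_wpDr ?exprn_even_gt0 //.
      by apply: sumr_ge0 => ? _; rewrite sqr_ge0.
    have [/existsP[j zj]|] := boolP [exists j, z (Some j) != 0].
      apply: ltr_wpDr; last by apply: top_gram => //; exists j.
      by rewrite mulr_ge0 ?sqr_ge0 // exprn_ge0 // ltW.
    rewrite negb_exists => /forallP z0.
    have zs j : z (Some j) = 0 by apply/eqP; have := z0 j; rewrite negbK.
    rewrite [quadform _ _]big1 ?add0r => [|u' _]; last first.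
      by rewrite big1 // => v _; rewrite /z'; case: u' => [j|]; rewrite ?zs mulr0 mul0r.
    apply: mulr_gt0; first exact: exprn_gt0.
    rewrite exprn_even_gt0 //=.
    by case: u zu => [j|//]; rewrite zs eqxx.
  - rewrite -[RHS](yhomogenized_yhomog 0 p_yhomog) -gram_sum //.
    apply: eq_bigr => u _; apply: eq_bigr => v _; rewrite /M.
    case: u v => [j|] [j'|] /=; rewrite ?addr0 //.
    by rewrite mpolyC0 mul0r !mulr0.
(* Homogeneity of degree 2 in [y] is excluded in this case, and any other degree would make the part
   of degree 2 vanish, although it is positive at the all-ones vectors. *)
have p_pos' : forall (x : 'rV[R]_n) (y : 'rV[R]_m), x != 0 -> 0 < eval_xy p x y.
  apply: p_pos => -[k pk]; move/negP: np2; apply; apply/allP => g gp.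
  rewrite (pk g gp); apply: contraT => k2.
  have const_neq0 k' : (0 < k')%N -> const_mx 1 != 0 :> 'rV[R]_k'.
    by move=> k0; apply/negP => /eqP /rowP /(_ (Ordinal k0)) /eqP; rewrite !mxE oner_eq0.
  have := top_pos _ _ (const_neq0 n n_gt0) (const_neq0 m m_gt0).
  rewrite /bihomog_part big_seq_cond big1 => [|h /and3P[hp _]].
    by rewrite /eval_xy meval0 ltxx.
  by rewrite (pk h hp) (negPf k2).
apply: (@gram_certificate R n m d t p C 1 (gram p)) => //.
- by move=> u v; apply: dhomog_gram.
- exact: gram_sym.
- exact: gram_sparse.
- move=> x z xnz [u zu].
  (* At [z None = 0] the part of degree 2 decides; otherwise division by [z None] leads to a value
     of [p] itself. *)
  have [z0|z0] := eqVneq (z None) 0.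
    by apply: top_gram => //; case: u zu => [j|]; [exists j|rewrite z0 eqxx].
  pose z1 u := z u / z None.
  have -> : quadform (fun u v => (gram p u v).@[x]) z =
            z None ^+ 2 * quadform (fun u v => (gram p u v).@[x]) z1.
    rewrite /quadform mulr_sumr; apply: eq_bigr => u' _.
    rewrite mulr_sumr; apply: eq_bigr => v _; rewrite /z1.
    by field.
  rewrite mulr_gt0 ?exprn_even_gt0 // gram_evalx /z1 divff // yhomogenized1.
  exact/p_pos'/x_neq0.
- by rewrite gram_sum // yhomogenized1.
Qed.
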